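(* Let $P_1$ and $P_2$ be real constant coefficient ordinary differential operators of orders $n_1\ge 2$ and $n_2\ge 2$, and let $\Sigma:\mathbb{R}^2\to\mathbb{R}^{n_1n_2}$, $\Sigma(t_1,t_2)=\sigma_1(t_1)\otimes\sigma_2(t_2)$, be the associated surface. If all the roots of the characteristic polynomials $\mathcal{P}_1$ and $\mathcal{P}_2$ are simple and if the real roots are dominant, then $\Sigma$ is a proper embedding of $\mathbb{R}^2$ in $\mathbb{R}^{n_1n_2}$ which is geodesically complete (with respect to the metric induced from the Euclidean metric) and which has infinite volume.
   Context: For $i=1,2$ let $P_i(\phi)=\phi^{(n_i)}+c_{i,n_i-1}\phi^{(n_i-1)}+\dots+c_{i,0}\phi$ be a real constant coefficient ordinary differential operator of order $n_i\ge2$ with characteristic polynomial $\mathcal{P}_i(\lambda)=\lambda^{n_i}+c_{i,n_i-1}\lambda^{n_i-1}+\dots+c_{i,0}$ and set of complex roots $\mathcal{R}_i$. Assume all roots are simple. Write $\mathcal{R}_1=\{r_1,\dots,r_k,x_1\pm y_1\sqrt{-1},\dots,x_p\pm y_p\sqrt{-1}\}$ and $\mathcal{R}_2=\{s_1,\dots,s_\ell,z_1\pm w_1\sqrt{-1},\dots,z_q\pm w_q\sqrt{-1}\}$, where $r_1>\dots>r_k$ and $s_1>\dots>s_\ell$ are the real roots and $y_j,w_j>0$. Define $\sigma_1(t_1)=(e^{r_1t_1},\dots,e^{r_kt_1},e^{x_1t_1}\cos(y_1t_1),e^{x_1t_1}\sin(y_1t_1),\dots)\in\mathbb{R}^{n_1}$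 and $\sigma_2(t_2)=(e^{s_1t_2},\dots,e^{s_\ell t_2},e^{z_1t_2}\cos(w_1t_2),e^{z_1t_2}\sin(w_1t_2),\dots)\in\mathbb{R}^{n_2}$. The surface is $\Sigma(t_1,t_2)=\sigma_1(t_1)\otimes\sigma_2(t_2)\in\mathbb{R}^{n_1}\otimes\mathbb{R}^{n_2}=\mathbb{R}^{n_1n_2}$, i.e. its coordinates are all products of a coordinate of $\sigma_1(t_1)$ with a coordinate of $\sigma_2(t_2)$; $\mathbb{R}^{n_1n_2}$ carries the standard Euclidean inner product. ''The real roots are dominant'' means: $r_1>0$ and $r_1>\Re(\mu)$ for all $\mu\in\mathcal{R}_1\setminus\{r_1\}$; $r_k<0$ and $r_k<\Re(\mu)$ for all $\mu\in\mathcal{R}_1\setminus\{r_k\}$; $s_1>0$ and $s_1>\Re(\mu)$ for all $\mu\in\mathcal{R}_2\setminus\{s_1\}$; $s_\ell<0$ and $s_\ell<\Re(\mu)$ for all $\mu\in\mathcal{R}_2\setminus\{s_\ell\}$. The volume of $\Sigma$ is $\int_{\mathbb{R}^2} g\,dt_1dt_2$, where $g=\sqrt{g_{11}g_{22}-g_{12}^2}$ and $g_{ij}=(\partial_{t_i}\Sigma,\partial_{t_j}\Sigma)$. *)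

(* Defs.v *)
From HB Require Import structures.
From mathcomp Require Import all_boot all_order all_algebra.
From mathcomp Require Import all_classical all_reals all_analysis.
From mathcomp.real_closed Require Import complex mxtens.

Set Implicit Arguments.
Unset Strict Implicit.
Unset Printing Implicit Defensive.

Import Order.TTheory GRing.Theory Num.Theory.
Import numFieldNormedType.Exports.

Local Open Scope classical_set_scope.
Local Open Scope ring_scope.
Local Open Scope complex_scope.

(* The monic operator phi |-> phi^(n) + c_(n-1) phi^(n-1) + ... + c_0 phi is
   given by its order n and its coefficient vector c. *)
Definition ode_char_poly (R : realType) (n : nat) (c : 'I_n -> R) : {poly R} :=
  'X^n + \sum_(j < n) c j *: 'X^j.

Definition complex_poly (R : realType) (P : {poly R}) : {poly R[i]} :=
  map_poly (real_complex R) P.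

Definition simple_roots (R : realType) (P : {poly R}) : Prop :=
  forall mu : R[i],
    root (complex_poly P) mu -> mup mu (complex_poly P) = 1%N.

(* rs lists the real roots r_1 > ... > r_k; zs lists, once each, the roots
   x_j + y_j i with y_j > 0, i.e. one root of each conjugate pair. *)
Definition root_enumeration (R : realType) (P : {poly R})
    (rs : seq R) (zs : seq R[i]) : Prop :=
  [/\ sorted >%R rs,
      uniq zs,
      forall z, z \in zs -> 0 < complex.Im z
    & forall mu : R[i], root (complex_poly P) mu =
        (mu \in [seq r%:C | r <- rs] ++ zs ++ [seq z^* | z <- zs])].

(* When rs is empty, head 0 rs = 0 and the condition is false, as it should. *)
Definition real_roots_dominant (R : realType) (P : {poly R}) (rs : seq R)
    : Prop :=
  [/\ 0 < head 0 rs,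
      forall mu : R[i], root (complex_poly P) mu -> mu != (head 0 rs)%:C ->
        complex.Re mu < head 0 rs,
      last 0 rs < 0
    & forall mu : R[i], root (complex_poly P) mu -> mu != (last 0 rs)%:C ->
        last 0 rs < complex.Re mu].

(* The list of coordinates has exactly n entries when rs and zs enumerate the
   roots of a polynomial of degree n all of whose roots are simple. *)
Definition ode_curve (R : realType) (n : nat) (rs : seq R) (zs : seq R[i])
    (t : R) : 'rV[R]_n :=
  \row_(i < n) nth 0
    ([seq expR (r * t) | r <- rs] ++
     flatten [seq [:: expR (complex.Re z * t) * cos (complex.Im z * t);
                      expR (complex.Re z * t) * sin (complex.Im z * t)]
             | z <- zs]) i.

(* u *t v is the Kronecker product of matrices; for row vectors it lists the
   products of a coordinate of u with a coordinate of v. *)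
Definition tensor_surface (R : realType) (n1 n2 : nat)
    (sigma1 : R -> 'rV[R]_n1) (sigma2 : R -> 'rV[R]_n2)
    (t : R * R) : 'rV[R]_(n1 * n2) :=
  sigma1 t.1 *t sigma2 t.2.

Definition dotrv (R : realType) (N : nat) (u v : 'rV[R]_N) : R :=
  \sum_(i < N) u 0 i * v 0 i.

Definition coord2 (R : realType) (i : 'I_2) (p : R * R) : R :=
  if i == 0 then p.1 else p.2.

Definition basis2 (R : realType) (i : 'I_2) : R * R :=
  if i == 0 then (1, 0) else (0, 1).

Definition partial (R : realType) (V : normedModType R) (i : 'I_2)
    (f : R * R -> V) : R * R -> V :=
  'D_(basis2 R i) f.

Definition smooth2 (R : realType) (V : normedModType R) (f : R * R -> V)
    : Prop :=
  forall (s : seq 'I_2) (t : R * R),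
    differentiable (foldr (fun i g => partial i g) f s) t.

Definition immersion2 (R : realType) (V : normedModType R) (f : R * R -> V)
    : Prop :=
  forall t : R * R, injective ('d f t : R * R -> V).

(* h is the inverse homeomorphism on the image, for the subspace topology. *)
Definition topological_embedding (T U : topologicalType) (f : T -> U) : Prop :=
  continuous f /\
  exists h : U -> T, cancel f h /\ {within range f, continuous h}.

Definition proper_map (T U : topologicalType) (f : T -> U) : Prop :=
  forall K : set U, compact K -> compact (f @^-1` K).

Definition proper_embedding (R : realType) (V : normedModType R)
    (f : R * R -> V) : Prop :=
  [/\ smooth2 f, immersion2 f, topological_embedding f & proper_map f].

Definition induced_metric (R : realType) (N : nat) (f : R * R -> 'rV[R]_N)
    (t : R * R) : 'M[R]_2 :=
  \matrix_(i < 2, j < 2) dotrv (partial i f t) (partial j f t).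

Definition christoffel (R : realType) (G : R * R -> 'M[R]_2)
    (k i j : 'I_2) (t : R * R) : R :=
  2^-1 * \sum_(l < 2) invmx (G t) k l *
    (partial i (fun u => G u j l) t + partial j (fun u => G u i l) t
     - partial l (fun u => G u i j) t).

Definition geodesic (R : realType) (G : R * R -> 'M[R]_2) (gamma : R -> R * R)
    : Prop :=
  let x (k : 'I_2) : R -> R := fun s => coord2 k (gamma s) in
  forall (k : 'I_2) (s : R),
    [/\ derivable (x k) s 1, derivable (derive1 (x k)) s 1
      & derive1n 2 (x k) s + \sum_(i < 2) \sum_(j < 2)
          christoffel G k i j (gamma s) * derive1 (x i) s * derive1 (x j) s = 0].

(* The exponential map is defined on the whole tangent bundle: the geodesic
   with any given initial point and initial velocity exists for all times. *)
Definition geodesically_complete (R : realType) (G : R * R -> 'M[R]_2)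
    : Prop :=
  forall p v : R * R, exists gamma : R -> R * R,
    [/\ geodesic G gamma, gamma 0 = p
      & forall k : 'I_2, derive1 (fun s => coord2 k (gamma s)) 0 = coord2 k v].

Definition volume_density (R : realType) (N : nat) (f : R * R -> 'rV[R]_N)
    (t : R * R) : R :=
  let g := induced_metric f t in
  Num.sqrt (g 0 0 * g 1 1 - g 0 1 ^+ 2).

Definition surface_volume (R : realType) (N : nat) (f : R * R -> 'rV[R]_N)
    : \bar R :=
  (\int[(@lebesgue_measure R \x @lebesgue_measure R)%E]_t
     (volume_density f t)%:E)%E.

(* Main.v *)
(* Write a = |sigma_1|^2 and b = |sigma_2|^2. Each curve has two coordinates
   exp(r t) and exp(q t) with q < 0 < r, and this is all that is used of the
   dominance of the real roots: it gives a(t) >= 1 + m |t|, and the Gram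
   determinant of (sigma, sigma') is at least d exp(-k |t|) > 0. The metric is
   g_11 = |sigma_1'|^2 b, g_12 = <sigma_1, sigma_1'> <sigma_2, sigma_2'>,
   g_22 = a |sigma_2'|^2.

   Since |Sigma|^2 = a b tends to infinity, Sigma is proper; the logarithms of
   three coordinates of Sigma give a continuous inverse. The density g is bounded
   below on [0, 1] x [0, oo), so the volume is infinite. A geodesic has constant
   energy E, and Cauchy-Schwarz gives |(a b)'| <= a b + E along it, so a b grows at
   most exponentially: position and velocity remain bounded in finite time, and
   Picard iteration yields a solution for all times. *)
Require Import Defs.
From HB Require Import structures.
From mathcomp Require Import all_boot all_order all_algebra.
From mathcomp Require Import all_classical all_reals all_analysis.
From mathcomp.real_closed Require Import complex mxtens.
From mathcomp Require Import measurable_realfun ring lra.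

Set Implicit Arguments.
Unset Strict Implicit.
Unset Printing Implicit Defensive.

Import Order.TTheory GRing.Theory Num.Theory.
Import numFieldNormedType.Exports.

Local Open Scope classical_set_scope.
Local Open Scope ring_scope.
Local Open Scope complex_scope.

(** * Global solutions of ordinary differential equations *)

(** Completeness is proved on the geodesic equation itself rather than through Cauchy sequences.
    That equation is quadratic in the velocity and not globally Lipschitz, so the field is
    multiplied by a cutoff chi(t) in [0, 1]. The slowed equation still obeys the a priori estimates:
    chi factors out of the derivative of the energy, which therefore stays constant, and chi <= 1
    can only weaken growth. The cutoff then turns out to equal 1 all along the solution. The
    exponential lower bound on the Gram determinant serves twice. Christoffel symbols divide by the
    determinant of the metric, and a lower bound on bounded sets makes them locally Lipschitz; it
    also converts constant energy into bounded velocity. The components of the surface and of its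
    metric lie in the algebra generated by exponentials, sines and cosines. Its closure under
    derivation reduces smoothness, measurability and Lipschitz bounds to inductions over
    generators. *)

Lemma is_derive_continuous (R : realType) (f df : R -> R) :
  (forall t : R, is_derive t 1 f (df t)) -> continuous f.
Proof.
move=> H t; apply: differentiable_continuous.
by apply/derivable1_diffP; case: (H t).
Qed.

Lemma is_derive_mvt (R : realType) (f df : R -> R) (a b : R) :
  (forall t : R, is_derive t 1 f (df t)) -> a <= b ->
  exists2 c, a <= c <= b & f b - f a = df c * (b - a).
Proof.
move=> H ab.
have cf : {within `[a, b], continuous f}.
  by apply: continuous_subspaceT => t; exact: is_derive_continuous.
have [c cab ->] := MVT_segment ab (fun s _ => H s) cf.
by exists c => //; move: cab; rewrite in_itv.
Qed.

Lemma is_derive_reflect (R : realType) (f df : R -> R) :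
  (forall t : R, is_derive t 1 f (df t)) ->
  forall t : R, is_derive t 1 (fun s => f (- s)) (- df (- t)).
Proof.
move=> H t; have Hn := H (- t).
have : is_derive t 1 (f \o -%R) (df (- t) * -1) by exact: is_derive1_comp.
by rewrite mulrN1.
Qed.

(** [C / K * expR (K * s) - f s] has a nonnegative derivative on [[0, t]]; the term [C / K] from its
    value at 0 is nonnegative and is dropped. *)
Lemma le_derive_exp (R : realType) (f df : R -> R) (C K t : R) :
  (forall t : R, is_derive t 1 f (df t)) -> 0 < K -> 0 <= C -> 0 <= t ->
  (forall s, 0 <= s <= t -> df s <= C * expR (K * s)) ->
  f t - f 0 <= C / K * expR (K * t).
Proof.
move=> H K0 C0 t0 le.
have H' (s : R) : is_derive s 1 (fun s => C / K * expR (K * s) - f s)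
    (C * expR (K * s) - df s).
  have Hs := H s; apply: is_derive_eq.
  by rewrite /GRing.scale/=; field; rewrite gt_eqF.
have [c cab] := is_derive_mvt H' t0.
have : 0 <= (C * expR (K * c) - df c) * (t - 0).
  by rewrite mulr_ge0 ?subr_ge0// le.
move=> /[swap] <-; rewrite mulr0 expR0 mulr1 => h.
have : 0 <= C / K by rewrite divr_ge0// ltW.
by move: h; lra.
Qed.

(** Integration gains the factor [1 / K] in the weighted norm, which is the source of contraction in
    Picard iteration. Negative times are reduced to positive ones by reflection. *)
Lemma norm_le_derive_exp (R : realType) (f df : R -> R) (C K T : R) :
  (forall t : R, is_derive t 1 f (df t)) -> 0 < K -> 0 <= C -> f 0 = 0 ->
  (forall s, `|s| <= T -> `|df s| <= C * expR (K * `|s|)) ->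
  forall t, `|t| <= T -> `|f t| <= C / K * expR (K * `|t|).
Proof.
move=> H K0 C0 f0 le t tT.
wlog t0 : f df H f0 le t tT / 0 <= t.
  move=> wl; have [t0|/ltW t0] := leP 0 t; first exact: (wl f df).
  have := wl (fun s => f (- s)) (fun s => - df (- s)) (is_derive_reflect H)
    _ _ (- t); rewrite !normrN opprK; apply => //.
  - by rewrite oppr0.
  - by move=> s sT; rewrite normrN -(normrN s) le// normrN.
  - by rewrite oppr_ge0.
have le' s : 0 <= s <= t -> `|df s| <= C * expR (K * s).
  move=> /andP[s0 st]; rewrite -{2}(ger0_norm s0) le// ger0_norm//.
  by rewrite (le_trans st)// -(ger0_norm t0).
rewrite (ger0_norm t0) ler_norml; apply/andP; split.
- have H' (s : R) : is_derive s 1 (fun s => - f s) (- df s).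
    by have Hs := H s; apply: is_derive_eq.
  rewrite lerNl -[leLHS]subr0 -[X in _ - X]oppr0 -f0 (le_derive_exp H')//.
  by move=> s /le'; apply: le_trans; rewrite -normrN ler_norm.
- rewrite -[leLHS]subr0 -[X in _ - X]f0 (le_derive_exp H)//.
  by move=> s /le'; apply: le_trans; rewrite ler_norm.
Qed.

(** Stated on an interval because it is meant for integrals whose derivative is known only to the
    right of their lower limit. *)
Lemma is_derive0_cst (R : realType) (f df : R -> R) (a b : R) :
  (forall t, a <= t <= b -> is_derive t 1 f (df t)) ->
  (forall t, a <= t <= b -> df t = 0) -> a <= b -> f b = f a.
Proof.
move=> H H0 ab.
have [//|s sab||c cab] := @MVT_segment R f df a b.
- by apply: H; move: sab; rewrite in_itv/= => /andP[/ltW-> /ltW->].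
- apply: continuous_in_subspaceT => t /set_mem/=; rewrite in_itv/= => tab.
  apply: differentiable_continuous; apply/derivable1_diffP.
  by case: (H t tab).
- by rewrite H0 ?mul0r; [move/eqP; rewrite subr_eq0 => /eqP|exact: cab].
Qed.

(** An integral needs a lower limit to the left of the point, so a global primitive is glued from
    the integrals [F n] starting at [- n%:R]. Once normalized to vanish at 0, they agree to the
    right of both lower limits. *)
Lemma continuous_antiderivative (R : realType) (g : R -> R) :
  continuous g ->
  exists G : R -> R, G 0 = 0 /\ forall t : R, is_derive t 1 G (g t).
Proof.
move=> cg.
pose mu := @lebesgue_measure R.
pose F (n : nat) (x : R) : R := (\int[mu]_(t in `[- n%:R, x]) g t)%R.
have dF n (x : R) : - n%:R < x -> is_derive x 1 (F n) (g x).
  move=> nx; have [||||dF gF] := @continuous_FTC1_closed R g (- n%:R) x (x + 1).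
  - by rewrite ltrDl.
  - apply: continuous_compact_integrable; first exact: segment_compact.
    exact: continuous_subspaceT.
  - by [].
  - exact: cg.
  - by split; [exact: dF|rewrite -derive1E; exact: gF].
have diff (m n : nat) (x : R) : (n <= m)%N -> - n%:R < x -> - n%:R < 0 :> R ->
    F m x - F m 0 = F n x - F n 0.
  move=> nm nx n0.
  have mn : - m%:R <= - n%:R :> R by rewrite lerN2 ler_nat.
  pose h y := F m y - F n y.
  have dh (y : R) : - n%:R < y -> is_derive y 1 h 0.
    move=> ny; have := dF n y ny; have := dF m y (le_lt_trans mn ny) => *.
    by apply: is_derive_eq; rewrite subrr.
  suff : h x = h 0.
    by rewrite /h => e; rewrite -[F m x](subrK (F n x)) e; ring.
  have [x0|x0] := leP 0 x.
    apply: (@is_derive0_cst _ h (fun=> 0)) => // t /andP[t0 _].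
    by apply: dh; rewrite (lt_le_trans n0).
  apply/esym/(@is_derive0_cst _ h (fun=> 0)) => //; last exact: ltW.
  by move=> t /andP[t0 _]; apply: dh; rewrite (lt_le_trans nx).
pose N (x : R) := (Num.truncn `|x|).+1.
have NP (x : R) : - (N x)%:R < x.
  by have := truncnS_gt `|x|; rewrite -/(N x) => h; have := lerNnormlW (lexx `|x|); lra.
pose G x := F (N x) x - F (N x) 0.
have GE (x : R) n : `|x| < n%:R -> G x = F n x - F n 0.
  move=> xn; have n0 : - n%:R < 0 :> R by rewrite oppr_lt0 (le_lt_trans _ xn).
  have N0 : - (N x)%:R < 0 :> R by rewrite oppr_lt0.
  have nx : - n%:R < x by have := lerNnormlW (lexx `|x|); lra.
  have [le|/ltnW le] := leqP n (N x); first exact: diff.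
  exact/esym/diff.
exists G; split => [|t]; first by rewrite /G subrr.
(* A fixed [n] larger than [|t|]: near [t] the glued function is [F n] up to a constant, although
   [N x] may jump. *)
pose n := (N t).+1.
have : is_derive t 1 (fun x => F n x - F n 0) (g t).
  have /dF h : - n%:R < t by have := NP t; rewrite /n -natr1; lra.
  by apply: is_derive_eq; rewrite subr0.
apply: (@near_eq_is_derive _ _ _ _ _ _ _ (g t)).
have tn : `|t| < n%:R by have := truncnS_gt `|t|; rewrite /n /N -(natr1 (_.+1)); lra.
have : \forall x \near t, `|x| < n%:R.
  apply: (@cvgr_lt _ _ (nbhs t) _ (fun x : R => `|x|) `|t|) => //.
  exact: (@norm_continuous _ R^o).
by apply: filterS => x /GE ->.
Qed.

(** The intervals of radius [2 * C / 2 ^+ k] about [u k] are nested, since one step moves the centre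
    by no more than the radius shrinks. The supremum of the left endpoints lies in all of them. *)
Lemma geometric_cauchy_limit (R : realType) (u : nat -> R) (C : R) :
  0 <= C -> (forall k, `|u k.+1 - u k| <= C / 2 ^+ k) ->
  exists l : R, forall k, `|u k - l| <= 2 * C / 2 ^+ k.
Proof.
move=> C0 H.
pose a k := u k - 2 * C / 2 ^+ k; pose b k := u k + 2 * C / 2 ^+ k.
have e0 k : 0 <= C / 2 ^+ k by rewrite divr_ge0// exprn_ge0.
have eS k : 2 * C / 2 ^+ k.+1 = C / 2 ^+ k.
  by rewrite exprS; field; rewrite expf_neq0.
have eM k : 2 * C / 2 ^+ k = 2 * (C / 2 ^+ k) by rewrite mulrA.
have da k : a k <= a k.+1.
  by have := H k; rewrite ler_norml /a eS eM; lra.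
have db k : b k.+1 <= b k.
  by have := H k; rewrite ler_norml /b eS eM; lra.
have ma : {homo a : m n / (m <= n)%N >-> m <= n} by exact/nondecreasing_seqP.
have mb : {homo b : m n / (m <= n)%N >-> n <= m} by exact/nonincreasing_seqP.
have ab j k : a j <= b k.
  apply: (le_trans (ma _ _ (leq_maxl j k))).
  apply: le_trans (mb _ _ (leq_maxr j k)).
  by rewrite /a /b eM; have := e0 (maxn j k); lra.
have supa : has_sup (range a).
  split; first by exists (a 0%N), 0%N.
  by exists (b 0%N) => _ [j _ <-].
exists (sup (range a)) => k.
have h1 : a k <= sup (range a) by apply: ub_le_sup; [case: supa|exists k].
have h2 : sup (range a) <= b k.
  by apply: ge_sup; [case: supa|move=> _ [j _ <-]].
by rewrite distrC ler_distl; apply/andP; split.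
Qed.

(** Replaces passage to the limit in the error estimates for Picard iterates. *)
Lemma geometric_le0 (R : realType) (x C : R) :
  (forall k, x <= C / 2 ^+ k) -> x <= 0.
Proof.
move=> H; rewrite leNgt; apply/negP => x0.
have C0 : 0 < C by have := H 0%N; rewrite expr0 divr1; exact: lt_le_trans.
have := truncnS_gt (C / x); set n := (_).+1 => Cn.
have := H n; rewrite leNgt => /negP; apply.
rewrite ltr_pdivrMr ?exprn_gt0// mulrC -ltr_pdivrMr// (lt_trans Cn)//.
by rewrite -natrX ltr_nat ltn_expl.
Qed.

Lemma local_lipschitz_continuous (R : realType) (g : R -> R) :
  (forall T : R, exists L : R, forall s t : R, `|s| <= T -> `|t| <= T ->
    `|g s - g t| <= L * `|s - t|) ->
  continuous g.
Proof.
move=> H t; have [L HL] := H (`|t| + 1).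
have L0 : 0 < `|L| + 1 by rewrite ltr_pwDr.
apply/(@cvgrPdist_le _ R^o) => e e0; near=> s.
have st : `|t - s| < e / (`|L| + 1).
  by near: s; apply: (@cvgr_dist_lt _ _ _ (nbhs t) _ id t) => //; exact: divr_gt0.
have s1 : `|t - s| < 1.
  by near: s; apply: (@cvgr_dist_lt _ _ _ (nbhs t) _ id t).
have sT : `|s| <= `|t| + 1.
  have := ler_normB t (t - s); rewrite opprB addrC subrK => /le_trans; apply.
  by rewrite lerD2l ltW.
apply: (le_trans (HL _ _ _ sT)); first by rewrite lerDl.
apply: (@le_trans _ _ ((`|L| + 1) * `|t - s|)).
  by rewrite ler_wpM2r// (le_trans (ler_norm _))// lerDl.
by rewrite mulrC -ler_pdivlMr// ltW.
Unshelve. all: by end_near. Qed.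

(* Picard iteration; on [-T, T] the weight [expR (K * `|t|)] with [K >= 2 L]
   makes one step a contraction of ratio 1/2. *)
Theorem picard_global (R : realType) (I : Type) (f : R -> (I -> R) -> I -> R)
    (y0 : I -> R) :
  (forall y : R -> I -> R, (forall i, continuous (fun t => y t i)) ->
     forall i, continuous (fun t => f t (y t) i)) ->
  (forall T : R, exists B : R, forall (t : R) x i, `|t| <= T -> `|f t x i| <= B) ->
  (forall T : R, exists L : R, forall (t : R) x y (d : R), `|t| <= T ->
     (forall i, `|x i - y i| <= d) -> forall i, `|f t x i - f t y i| <= L * d) ->
  exists y : R -> I -> R, y 0 = y0 /\
    forall i (t : R), is_derive t 1 (fun s => y s i) (f t (y t) i).
Proof.
move=> cf bf lf.
(* A total antiderivative operator, with junk values on discontinuous functions, so that [step] can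
   be iterated before continuity is known. *)
have /choice[A AP] : forall g : R -> R, exists G : R -> R, continuous g ->
    G 0 = 0 /\ forall t : R, is_derive t 1 G (g t).
  move=> g; have [cg|ncg] := pselect (continuous g); last by exists g.
  by have [G GP] := continuous_antiderivative cg; exists G.
pose step (y : R -> I -> R) (t : R) (i : I) :=
  y0 i + A (fun s => f s (y s) i) t.
pose cont (y : R -> I -> R) := forall i, continuous (fun t => y t i).
have dstep y : cont y -> forall i (t : R),
    is_derive t 1 (fun s => step y s i) (f t (y t) i).
  move=> cy i t; have [_ /(_ t) h] := AP _ (cf y cy i).
  have : is_derive t 1 (cst (y0 i) + A (fun s => f s (y s) i)) (0 + f t (y t) i).
    exact: is_deriveD.
  by rewrite add0r.
have step0 y : cont y -> step y 0 = y0.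
  by move=> cy; apply/funext => i; rewrite /step (AP _ (cf y cy i)).1 addr0.
have cstep y : cont y -> cont (step y).
  by move=> cy i; exact: is_derive_continuous (dstep y cy i).
pose Y k := iter k step (fun=> y0).
have cY k : cont (Y k).
  by elim: k => [i t|k IH]; [exact: cvg_cst|exact: cstep].
have Y0 k : Y k 0 = y0 by case: k => // k; exact: step0.
have /choice[B BP] := bf.
have /choice[L LP] := lf.
(* The summand 1 keeps [K] positive when [L T] is 0; [C T] bounds the first Picard step in the
   weighted norm. *)
pose K (T : R) := 2 * `|L T| + 1.
pose C (T : R) := `|B T| / K T.
have K0 T : 0 < K T by rewrite /K ltr_pwDr// mulr_ge0.
have C0 T : 0 <= C T by rewrite /C divr_ge0// ltW.
have contr y z (D T : R) : cont y -> cont z -> 0 <= D ->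
    (forall i (t : R), `|t| <= T -> `|y t i - z t i| <= D * expR (K T * `|t|)) ->
    forall i (t : R), `|t| <= T ->
    `|step y t i - step z t i| <= D / 2 * expR (K T * `|t|).
  move=> cy cz D0 yz i t tT.
  have dd (s : R) : is_derive s 1 (fun s => step y s i - step z s i)
      (f s (y s) i - f s (z s) i).
    have := dstep y cy i s; have := dstep z cz i s => h1 h2.
    by apply: is_derive_eq.
  have dL (s : R) : `|s| <= T -> `|f s (y s) i - f s (z s) i| <=
      `|L T| * D * expR (K T * `|s|).
    move=> sT; have := LP T s (y s) (z s) _ sT (fun i => yz i s sT) i.
    move=> /le_trans; apply; rewrite -mulrA ler_wpM2r ?ler_norm//.
    by rewrite mulr_ge0// expR_ge0.
  have := norm_le_derive_exp dd (K0 T) _ _ dL tT.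
  move=> /(_ _ _)/le_trans; apply.
  - by rewrite mulr_ge0.
  - by rewrite !step0// subrr.
  - rewrite ler_wpM2r ?expR_ge0// ler_pdivrMr ?K0// mulrC -mulrA ler_wpM2l//.
    by rewrite /K; lra.
have dist k i (t T : R) : `|t| <= T ->
    `|Y k.+1 t i - Y k t i| <= C T / 2 ^+ k * expR (K T * `|t|).
  elim: k i t => [i t tT|k IH i t tT].
    have d1 (s : R) : is_derive s 1 (fun s => Y 1%N s i - y0 i) (f s y0 i).
      have h := dstep _ (cY 0%N) i s.
      have : is_derive s 1 ((fun s => step (Y 0%N) s i) - cst (y0 i))
          (f s y0 i - 0) by exact: is_deriveB.
      by rewrite subr0.
    rewrite expr0 divr1; apply: (norm_le_derive_exp d1 (K0 T)) tT => //.
    - by rewrite (Y0 1%N) subrr.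
    - move=> s sT; rewrite (le_trans (BP _ _ _ _ sT))// (le_trans (ler_norm _))//.
      by rewrite ler_peMr// -expR0 ler_expR mulr_ge0// ltW.
  rewrite exprSr invfM mulrA.
  apply: (contr (Y k.+1) (Y k) (C T / 2 ^+ k) T (cY _) (cY _) _ IH i t tT).
  by rewrite divr_ge0// exprn_ge0.
have lim i (t : R) : exists l : R, forall k,
    `|Y k t i - l| <= 2 * (C `|t| * expR (K `|t| * `|t|)) / 2 ^+ k.
  apply: geometric_cauchy_limit; first by rewrite mulr_ge0// expR_ge0.
  by move=> k; rewrite mulrAC dist.
have [y yP] : exists y : R -> I -> R, forall t i k,
    `|Y k t i - y t i| <= 2 * (C `|t| * expR (K `|t| * `|t|)) / 2 ^+ k.
  have /choice[yy yyP] : forall ti : R * I, exists l : R, forall k,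
      `|Y k ti.1 ti.2 - l| <=
      2 * (C `|ti.1| * expR (K `|ti.1| * `|ti.1|)) / 2 ^+ k.
    by move=> [t i]; exact: lim.
  by exists (fun t i => yy (t, i)) => t i; exact: (yyP (t, i)).
(* [y] was chosen with the constants of radius [|t|]. Uniqueness of the limit transfers the estimate
   to the constants of any larger [T], which makes it uniform on [[- T, T]]. *)
have yT (T : R) i (t : R) k : `|t| <= T ->
    `|Y k t i - y t i| <= 2 * C T / 2 ^+ k * expR (K T * `|t|).
  move=> tT; have [l lP] : exists l : R, forall k,
      `|Y k t i - l| <= 2 * (C T * expR (K T * `|t|)) / 2 ^+ k.
    apply: geometric_cauchy_limit; first by rewrite mulr_ge0// expR_ge0.
    by move=> j; rewrite mulrAC dist.
  suff -> : y t i = l by rewrite mulrAC -[2 * C T * _]mulrA lP.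
  apply/eqP; rewrite -subr_eq0 -normr_le0.
  apply: (@geometric_le0 _ _ (2 * (C `|t| * expR (K `|t| * `|t|)) +
    2 * (C T * expR (K T * `|t|)))) => j.
  rewrite mulrDl (le_trans (ler_distD (Y j t i) _ _))// lerD//.
  by rewrite distrC.
(* All iterates share the Lipschitz constant [|B T|] on [[- T, T]], and the limit inherits it. *)
have cy : cont y.
  move=> i; apply: local_lipschitz_continuous => T; exists `|B T| => s t sT tT.
  rewrite -subr_le0.
  apply: (@geometric_le0 _ _ (2 * C T * expR (K T * `|s|) +
    2 * C T * expR (K T * `|t|))) => k.
  have YL : `|Y k s i - Y k t i| <= `|B T| * `|s - t|.
    case: k => [|k]; first by rewrite subrr normr0 mulr_ge0.
    wlog st : s t sT tT / t <= s.
      move=> wl; have [ts|/ltW st] := leP t s; first exact: wl.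
      by rewrite distrC (distrC s) wl.
    have [c /andP[tc cs] ->] := is_derive_mvt (dstep _ (cY k) i) st.
    rewrite normrM ler_wpM2r// (le_trans _ (ler_norm _))// BP//.
    move: sT tT; rewrite !ler_norml => /andP[_ sT] /andP[tT _].
    by rewrite (le_trans tT tc) (le_trans cs sT).
  have h1 := yT T i s k sT; have h2 := yT T i t k tT.
  have h3 := ler_distD (Y k s i) (y s i) (y t i).
  have h4 := ler_distD (Y k t i) (Y k s i) (y t i).
  rewrite distrC in h1.
  by rewrite mulrDl; move: h1 h2; rewrite !(mulrAC _ (_ ^-1)); lra.
exists (step y).
suff ys : step y = y by split; [exact: step0|move=> i t; rewrite {2}ys; exact: dstep].
apply/funext => t; apply/funext => i; apply/eqP; rewrite -subr_eq0 -normr_le0.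
pose D := C `|t| * expR (K `|t| * `|t|).
apply: (@geometric_le0 _ _ (2 * D)) => k.
(* As [Y k.+1] is [step (Y k)], contraction makes it geometrically close to [step y], while it is
   also close to [y]. *)
have h1 : `|step y t i - Y k.+1 t i| <= 2 * C `|t| / 2 ^+ k / 2 * expR (K `|t| * `|t|).
  apply: (contr y (Y k) (2 * C `|t| / 2 ^+ k) `|t| cy (cY k)) => //.
  - by apply: divr_ge0; [exact: mulr_ge0|exact: exprn_ge0].
  - by move=> j s sT; rewrite distrC yT.
have h2 := yT `|t| i t k.+1 (lexx _).
rewrite (le_trans (ler_distD (Y k.+1 t i) _ _))// (le_trans (lerD h1 h2))//.
rewrite /D exprS le_eqVlt; apply/orP; left; apply/eqP.
by field; rewrite expf_neq0.
Qed.

(** * Locally Lipschitz functions of a family of coordinates *)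

Definition loc_lipschitz (R : realType) (I : Type) (g : (I -> R) -> R) : Prop :=
  forall M : R, exists B L : R,
    (forall x, (forall i, `|x i| <= M) -> `|g x| <= B) /\
    forall x y (d : R), (forall i, `|x i| <= M) -> (forall i, `|y i| <= M) ->
      (forall i, `|x i - y i| <= d) -> `|g x - g y| <= L * d.

Lemma loc_lipschitz_cst (R : realType) (I : Type) (c : R) :
  loc_lipschitz (fun _ : I -> R => c).
Proof.
move=> M; exists `|c|, 0; split=> // x y d _ _ _.
by rewrite subrr normr0 mul0r.
Qed.

Lemma loc_lipschitz_add (R : realType) (I : Type) (g h : (I -> R) -> R) :
  loc_lipschitz g -> loc_lipschitz h -> loc_lipschitz (fun x => g x + h x).
Proof.
move=> Hg Hh M; have [B [L [gB gL]]] := Hg M; have [B' [L' [hB hL]]] := Hh M.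
exists (B + B'), (L + L'); split=> [x xM|x y d xM yM xyd].
  by rewrite (le_trans (ler_normD _ _))// lerD ?gB ?hB.
rewrite opprD addrACA mulrDl (le_trans (ler_normD _ _))// lerD//.
- exact: gL.
- exact: hL.
Qed.

(** Products are the reason why [loc_lipschitz] records a bound [B] next to the Lipschitz
    constant. *)
Lemma loc_lipschitz_mul (R : realType) (I : Type) (g h : (I -> R) -> R) :
  loc_lipschitz g -> loc_lipschitz h -> loc_lipschitz (fun x => g x * h x).
Proof.
move=> Hg Hh M; have [B [L [gB gL]]] := Hg M; have [B' [L' [hB hL]]] := Hh M.
exists (B * B'), (B * L' + B' * L); split=> [x xM|x y d xM yM xyd].
  by rewrite normrM ler_pM ?gB ?hB.
have -> : g x * h x - g y * h y = g x * (h x - h y) + h y * (g x - g y) by ring.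
rewrite mulrDl (le_trans (ler_normD _ _))// -!mulrA !normrM.
by rewrite lerD// ler_pM ?gB ?hB ?gL ?hL.
Qed.

Lemma loc_lipschitz_sum (R : realType) (I : Type) (J : Type) (r : seq J)
    (g : J -> (I -> R) -> R) :
  (forall j, loc_lipschitz (g j)) ->
  loc_lipschitz (fun x => \sum_(j <- r) g j x).
Proof.
move=> H; elim: r => [|j r IH].
  by under eq_fun do rewrite big_nil; exact: loc_lipschitz_cst.
by under eq_fun do rewrite big_cons; exact: loc_lipschitz_add.
Qed.

Lemma loc_lipschitz_coord (R : realType) (I : Type) (i : I) :
  loc_lipschitz (fun x : I -> R => x i).
Proof. by move=> M; exists M, 1; split=> // x y d _ _ H; rewrite mul1r. Qed.

Lemma loc_lipschitz_norm (R : realType) (I : Type) (g : (I -> R) -> R) :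
  loc_lipschitz g -> loc_lipschitz (fun x => `|g x|).
Proof.
move=> H M; have [B [L [gB gL]]] := H M; exists B, L.
split=> [x xM|x y d xM yM xyd]; first by rewrite normr_id gB.
by rewrite (le_trans (ler_dist_dist _ _))// gL.
Qed.

Lemma loc_lipschitz_inv (R : realType) (I : Type) (g : (I -> R) -> R) :
  loc_lipschitz g ->
  (forall M : R, exists2 e : R, 0 < e & forall x, (forall i, `|x i| <= M) -> e <= g x) ->
  loc_lipschitz (fun x => (g x)^-1).
Proof.
move=> H P M; have [B [L [gB gL]]] := H M; have [e e0 ge] := P M.
exists e^-1, (L / e ^+ 2); split=> [x xM|x y d xM yM xyd].
  have gx := lt_le_trans e0 (ge x xM).
  rewrite ger0_norm; last by rewrite invr_ge0 ltW.
  by rewrite lef_pV2 ?posrE// ge.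
have gx := lt_le_trans e0 (ge x xM); have gy := lt_le_trans e0 (ge y yM).
have -> : (g x)^-1 - (g y)^-1 = (g y - g x) / (g x * g y).
  by field; rewrite !gt_eqF.
rewrite normrM distrC mulrAC ler_pM ?gL//.
rewrite ger0_norm; last by rewrite invr_ge0 ltW ?mulr_gt0.
by rewrite lef_pV2 ?posrE ?mulr_gt0 ?exprn_gt0// expr2 ler_pM ?ge// ltW.
Qed.

(** Finiteness of ['I_n] gives constants common to all components; summing absolute values also
    makes them nonnegative. *)
Lemma loc_lipschitz_family (R : realType) (I : Type) (n : nat)
    (F : (I -> R) -> 'I_n -> R) :
  (forall i, loc_lipschitz (fun x => F x i)) ->
  forall M : R, exists B L : R, [/\ 0 <= B, 0 <= L,
    (forall x, (forall i, `|x i| <= M) -> forall k, `|F x k| <= B) &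
    forall x y (d : R), 0 <= d ->
      (forall i, `|x i| <= M) -> (forall i, `|y i| <= M) ->
      (forall i, `|x i - y i| <= d) -> forall k, `|F x k - F y k| <= L * d].
Proof.
move=> H M.
have /choice[B BP] := fun i => H i M; have /choice[L LP] := BP.
exists (\sum_i `|B i|), (\sum_i `|L i|); split; rewrite ?sumr_ge0//.
- move=> x xM k; have [/(_ x xM) h _] := LP k.
  rewrite (le_trans h)// (le_trans (ler_norm _))// (bigD1 k)//= lerDl.
  by rewrite sumr_ge0.
- move=> x y d d0 xM yM xyd k; have [_ /(_ x y d xM yM xyd) h] := LP k.
  rewrite (le_trans h)// ler_wpM2r// (le_trans (ler_norm _))//.
  by rewrite (bigD1 k)//= lerDl sumr_ge0.
Qed.

Lemma loc_lipschitz_continuous (R : realType) (n : nat) (g : ('I_n -> R) -> R)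
    (y : R -> 'I_n -> R) :
  loc_lipschitz g -> (forall i, continuous (fun t => y t i)) ->
  continuous (fun t => g (y t)).
Proof.
(* The extra 1 leaves room for [y s] with [s] near [t], so that both points lie in the ball of
   radius [M]. *)
move=> H cy t; pose M : R := \sum_i `|y t i| + 1.
have [B [L [_ gL]]] := H M.
have L0 : 0 < `|L| + 1 by rewrite ltr_pwDr.
have yM i : `|y t i| <= M - 1.
  by rewrite /M addrK (bigD1 i)//= lerDl sumr_ge0.
apply/(@cvgrPdist_le _ R^o) => e e0.
pose d := Num.min 1 (e / (`|L| + 1)).
have d0 : 0 < d by rewrite lt_min ltr01 divr_gt0.
have : \forall s \near t, forall i, `|y t i - y s i| <= d.
  apply: (@filter_forall _ _ (fun i s => `|y t i - y s i| <= d) (nbhs t)) => i.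
  by have /(@cvgrPdist_le _ R^o) := cy i t; apply.
apply: filterS => s yd.
apply: (@le_trans _ _ (L * d)).
  apply: gL => // i; first by rewrite (le_trans (yM i))// gerBl.
  rewrite -[y s i](subKr (y t i)) (le_trans (ler_normB _ _))//.
  by rewrite -[leRHS](subrK 1) lerD// (le_trans (yd i))// /d ge_min lexx.
apply: (@le_trans _ _ ((`|L| + 1) * d)).
  by rewrite ler_wpM2r ?(ltW d0)// (le_trans (ler_norm _))// lerDl.
by rewrite mulrC -ler_pdivlMr// /d ge_min lexx orbT.
Qed.

(** A piecewise linear cutoff is enough, since Picard iteration asks only for a Lipschitz field. *)
Definition clamp01 (R : realType) (r : R) : R := Num.min 1 (Num.max 0 r).

Lemma clamp01_itv (R : realType) (r : R) : 0 <= clamp01 r <= 1.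
Proof. by rewrite /clamp01 le_min ler01 le_max lexx /= ge_min lexx. Qed.

Lemma clamp01_dist (R : realType) (r s : R) :
  `|clamp01 r - clamp01 s| <= `|r - s|.
Proof.
have h1 := ler_norm (r - s); have h2 := ler_norm (s - r).
rewrite distrC in h2; rewrite ler_norml /clamp01.
by case: (leP 0 r) => ?; case: (leP 0 s) => ?;
  rewrite /Num.min; do 2?case: ifP => ?; lra.
Qed.

Lemma clamp01_le0 (R : realType) (r : R) : r <= 0 -> clamp01 r = 0.
Proof. by move=> r0; rewrite /clamp01 max_l// min_r// ler01. Qed.

Lemma clamp01_ge1 (R : realType) (r : R) : 1 <= r -> clamp01 r = 1.
Proof.
by move=> r1; rewrite /clamp01 max_r ?min_l// (le_trans ler01).
Qed.

Lemma continuous_clamp01 (R : realType) : continuous (@clamp01 R).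
Proof.
apply: local_lipschitz_continuous => T; exists 1 => s t _ _.
by rewrite mul1r clamp01_dist.
Qed.

Lemma continuous_bounded_itv (R : realType) (f : R -> R) (T : R) :
  continuous f -> exists B : R, forall t : R, `|t| <= T -> `|f t| <= B.
Proof.
move=> cf; have [T0|T0] := ltP T 0.
  by exists 0 => t tT; have := lt_le_trans T0 (le_trans (normr_ge0 t) tT); rewrite ltxx.
have le : - T <= T by lra.
have cnf : {within `[- T, T], continuous (fun t => `|f t|)}.
  apply: continuous_subspaceT => t.
  apply: (@continuous_comp _ _ _ f (fun x : R => `|x|)); first exact: cf.
  exact: (@norm_continuous _ R^o).
have [c _ cP] := EVT_max le cnf.
by exists `|f c| => t tT; apply: cP; rewrite in_itv/= -ler_norml.
Qed.

(* The field is multiplied by a cutoff which is 1 in the region that the a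
   priori bound allows at time [t]; letting that region grow with [t] yields
   the global solution at once, without uniqueness and gluing. *)
Theorem global_solution (R : realType) (n : nat) (F : ('I_n -> R) -> 'I_n -> R)
    (y0 : 'I_n -> R) (M : R -> R) :
  (forall i, loc_lipschitz (fun x => F x i)) -> continuous M ->
  (forall (chi : R -> R) (y : R -> 'I_n -> R),
     (forall t, 0 <= chi t <= 1) -> y 0 = y0 ->
     (forall i (t : R), is_derive t 1 (fun s => y s i) (chi t * F (y t) i)) ->
     forall t i, `|y t i| <= M t) ->
  exists y : R -> 'I_n -> R, y 0 = y0 /\
    forall i (t : R), is_derive t 1 (fun s => y s i) (F (y t) i).
Proof.
move=> lF cM apriori.
pose N (x : 'I_n -> R) := \sum_i `|x i|.
have lN : loc_lipschitz N.
  by apply: loc_lipschitz_sum => i; apply/loc_lipschitz_norm/loc_lipschitz_coord.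
have xN (x : 'I_n -> R) i : `|x i| <= N x.
  by rewrite /N (bigD1 i)//= lerDl sumr_ge0.
(* [M t] bounds single coordinates, so [N x] is at most [n%:R * M t] in the allowed region and the
   cutoff is 1 there; one unit further out it vanishes. *)
pose cut (t : R) (x : 'I_n -> R) := clamp01 (n%:R * M t + 1 - N x).
pose f (t : R) x i := cut t x * F x i.
have bM (T : R) : exists B : R, forall t : R, `|t| <= T -> n%:R * M t + 1 <= B.
  have [B BP] := continuous_bounded_itv T cM.
  exists (n%:R * B + 1) => t tT; rewrite lerD2r ler_wpM2l//.
  exact: le_trans (ler_norm _) (BP t tT).
have cutN0 t x (r : R) : n%:R * M t + 1 <= r -> cut t x != 0 ->
    forall i, `|x i| <= r.
  move=> tr c0 i; rewrite (le_trans (xN x i))// (le_trans _ tr)//.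
  by apply: contraNT c0; rewrite -ltNge => h; rewrite /cut clamp01_le0// subr_le0 ltW.
have cut1 t x : `|cut t x| <= 1.
  by have /andP[h0 h1] := clamp01_itv (n%:R * M t + 1 - N x); rewrite ger0_norm.
have [|||y [y00 dy]] := @picard_global R 'I_n f y0.
- move=> y cy i.
  have ccut : continuous (fun t => cut t (y t)).
    move=> t; apply: (@continuous_comp _ _ _ (fun t => n%:R * M t + 1 - N (y t))
      (@clamp01 R)); last exact: continuous_clamp01.
    apply: (@cvgB _ R^o); last exact: (loc_lipschitz_continuous lN cy).
    apply: (@cvgD _ R^o); last exact: cvg_cst.
    by apply: cvgM; [exact: cvg_cst|exact: cM].
  move=> t; apply: (@cvgM _ _ (nbhs t) _ (fun t => cut t (y t)) (fun t => F (y t) i)).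
    exact: ccut.
  exact: (loc_lipschitz_continuous (lF i) cy).
- move=> T; have [r rP] := bM T; have [B [L [B0 L0 FB FL]]] := loc_lipschitz_family lF r.
  exists B => t x i tT; rewrite /f normrM.
  have [->|c0] := eqVneq (cut t x) 0; first by rewrite normr0 mul0r.
  rewrite -[leRHS]mul1r ler_pM//; apply: FB.
  exact: cutN0 (rP t tT) c0.
- move=> T; have [r rP] := bM T; have [B [L [B0 L0 FB FL]]] := loc_lipschitz_family lF r.
  exists (L + n%:R * B) => t x y d tT xyd i.
  have d0 : 0 <= d by exact: le_trans (xyd i).
  have cutL u v : (forall i, `|u i - v i| <= d) -> `|cut t u - cut t v| <= n%:R * d.
    move=> uv; rewrite (le_trans (clamp01_dist _ _))//.
    rewrite opprB addrC addrA subrK /N -sumrB (le_trans (ler_norm_sum _ _ _))//.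
    rewrite mulr_natl -[X in _ *+ X]card_ord -sumr_const ler_sum// => j _.
    by rewrite (le_trans (ler_dist_dist _ _))// distrC.
  (* if the cutoff vanishes at v, only the variation of the cutoff matters *)
  have half u v : (forall i, `|u i - v i| <= d) -> cut t v = 0 ->
      `|f t u i - f t v i| <= (L + n%:R * B) * d.
    move=> uv cv; rewrite /f cv mul0r subr0.
    have [->|c0] := eqVneq (cut t u) 0.
      by rewrite mul0r normr0 mulr_ge0// addr_ge0// mulr_ge0.
    rewrite normrM -[X in `|X| * _]subr0 -cv mulrDl.
    have := cutL u v uv; have := FB u (cutN0 _ _ _ (rP t tT) c0) i => h1 h2.
    rewrite (le_trans (ler_pM _ _ h2 h1))// mulrAC lerDr mulr_ge0//.
  have [cx|cx] := eqVneq (cut t x) 0.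
    by rewrite distrC half// => j; rewrite distrC.
  have [cy|cy] := eqVneq (cut t y) 0; first exact: half.
  have xr := cutN0 _ _ _ (rP t tT) cx; have yr := cutN0 _ _ _ (rP t tT) cy.
  rewrite /f.
  have -> : cut t x * F x i - cut t y * F y i =
    cut t x * (F x i - F y i) + (cut t x - cut t y) * F y i by ring.
  rewrite (le_trans (ler_normD _ _))// [leRHS]mulrDl !normrM lerD//.
    by rewrite -[leRHS]mul1r ler_pM// FL.
  by rewrite mulrAC ler_pM// ?cutL// FB.
- exists y; split=> // i t.
  (* The a priori bound, applied with [chi] the cutoff along [y] itself, shows that the cutoff never
     acts on this solution. *)
  suff cy1 : cut t (y t) = 1.
    by have := dy i t; rewrite /f cy1 mul1r.
  apply: clamp01_ge1; rewrite addrAC lerDr subr_ge0.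
  rewrite mulr_natl -[X in _ *+ X]card_ord -sumr_const ler_sum// => j _.
  by apply: (apriori (fun s => cut s (y s)) y) => // s; exact: clamp01_itv.
Qed.

(** * Exponential-trigonometric polynomials *)

(** An inductively generated algebra closed under [derive1], so that a property proved by induction
    passes to all iterated derivatives. *)
Inductive exp_trig (R : realType) : (R -> R) -> Prop :=
| exp_trig_cst c : exp_trig (fun=> c)
| exp_trig_exp r : exp_trig (fun t => expR (r * t))
| exp_trig_cos y : exp_trig (fun t => cos (y * t))
| exp_trig_sin y : exp_trig (fun t => sin (y * t))
| exp_trig_add f g : exp_trig f -> exp_trig g -> exp_trig (fun t => f t + g t)
| exp_trig_mul f g : exp_trig f -> exp_trig g -> exp_trig (fun t => f t * g t).

Lemma exp_trig_is_derive (R : realType) (f : R -> R) : exp_trig f ->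
  exists2 f', exp_trig f' & forall t : R, is_derive t 1 f (f' t).
Proof.
have lin (r t : R) : is_derive t 1 (fun t => r * t) r.
  by apply: is_derive_eq; rewrite /GRing.scale/= mulr1.
elim=> [c|r|y|y|{}f g _ [f' ef' df] _ [g' eg' dg]
  |{}f g ef [f' ef' df] eg [g' eg' dg]].
- by exists (fun=> 0) => [|t]; [exact: exp_trig_cst|exact: is_derive_cst].
- exists (fun t => expR (r * t) * r) => [|t].
    by apply: exp_trig_mul; [exact: exp_trig_exp|exact: exp_trig_cst].
  exact: (is_derive1_comp (is_derive_expR (r * t)) (lin r t)).
- exists (fun t => -1 * sin (y * t) * y) => [|t].
    by do 2?apply: exp_trig_mul; [exact: exp_trig_cst|exact: exp_trig_sin
      |exact: exp_trig_cst].
  rewrite mulN1r; exact: (is_derive1_comp (is_derive_cos (y * t)) (lin y t)).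
- exists (fun t => cos (y * t) * y) => [|t].
    by apply: exp_trig_mul; [exact: exp_trig_cos|exact: exp_trig_cst].
  exact: (is_derive1_comp (is_derive_sin (y * t)) (lin y t)).
- exists (fun t => f' t + g' t) => [|t]; first exact: exp_trig_add.
  exact: is_deriveD.
- exists (fun t => f t * g' t + g t * f' t) => [|t].
    by apply: exp_trig_add; exact: exp_trig_mul.
  exact: is_deriveM.
Qed.

Lemma is_derive_derive1 (R : realType) (f : R -> R) (t df : R) :
  is_derive t 1 f df -> derive1 f t = df.
Proof. by move=> h; rewrite derive1E derive_val. Qed.

Lemma exp_trig_derive1 (R : realType) (f : R -> R) : exp_trig f ->
  exp_trig (derive1 f) /\ forall t : R, is_derive t 1 f (derive1 f t).
Proof.
move=> /exp_trig_is_derive[f' ef' df].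
suff -> : (derive1 f) = f' by [].
by apply/funext => t; exact: is_derive_derive1.
Qed.

Lemma exp_trig_continuous (R : realType) (f : R -> R) :
  exp_trig f -> continuous f.
Proof. by move=> /exp_trig_derive1[_]; exact: is_derive_continuous. Qed.

(** The derivative is again in the class, hence bounded on [[- M, M]], and the mean value theorem
    applies. *)
Lemma exp_trig_loc_lipschitz (R : realType) (I : Type) (f : R -> R) (i : I) :
  exp_trig f -> loc_lipschitz (fun x : I -> R => f (x i)).
Proof.
move=> ef M; have [ef' df] := exp_trig_derive1 ef.
have [B BP] := continuous_bounded_itv M (exp_trig_continuous ef).
have [L LP] := continuous_bounded_itv M (exp_trig_continuous ef').
exists B, L; split=> [x xM|x y d xM yM xyd]; first exact: BP.
have [c cM ->] : exists2 c, `|c| <= M & f (x i) - f (y i) = derive1 f c * (x i - y i).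
  have := xM i; have := yM i; rewrite !ler_norml => /andP[y1 y2] /andP[x1 x2].
  have [yx|/ltW xy] := leP (y i) (x i).
    have [c /andP[c1 c2] e] := is_derive_mvt df yx; exists c => //.
    by rewrite ler_norml (le_trans y1 c1) (le_trans c2 x2).
  have [c /andP[c1 c2] e] := is_derive_mvt df xy; exists c.
    by rewrite ler_norml (le_trans x1 c1) (le_trans c2 y2).
  by rewrite -opprB e -mulrN opprB.
by rewrite normrM ler_pM// LP.
Qed.

Lemma exp_trig_sum (R : realType) (J : Type) (r : seq J) (f : J -> R -> R) :
  (forall j, exp_trig (f j)) -> exp_trig (fun t => \sum_(j <- r) f j t).
Proof.
move=> H; elim: r => [|j r IH].
  by under eq_fun do rewrite big_nil; exact: exp_trig_cst.
by under eq_fun do rewrite big_cons; exact: exp_trig_add.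
Qed.

(** Each generator depends on one variable, so a partial derivative acts on it as [derive1] or as 0;
    this makes the class stable under both. *)
Inductive exp_trig2 (R : realType) : (R * R -> R) -> Prop :=
| exp_trig2_fst f : exp_trig f -> exp_trig2 (fun t => f t.1)
| exp_trig2_snd f : exp_trig f -> exp_trig2 (fun t => f t.2)
| exp_trig2_add f g :
    exp_trig2 f -> exp_trig2 g -> exp_trig2 (fun t => f t + g t)
| exp_trig2_mul f g :
    exp_trig2 f -> exp_trig2 g -> exp_trig2 (fun t => f t * g t).

Lemma ord2P (P : 'I_2 -> Prop) : P 0 -> P 1 -> forall i, P i.
Proof.
by move=> P0 P1 [[|[|//]] i]; [move: P0|move: P1]; congr P; exact/val_inj.
Qed.

Lemma sum_ord2 (V : nmodType) (F : 'I_2 -> V) : \sum_i F i = F 0 + F 1.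
Proof.
rewrite big_ord_recl big_ord1; congr (_ + F _); exact/val_inj.
Qed.

Lemma partial0E (R : realType) (V : normedModType R) (f : R * R -> V) t :
  partial 0 f t = 'D_1 (fun x : R => f (x, t.2)) t.1.
Proof.
rewrite /partial /basis2 /= /derive.
apply: (congr1 (fun k : R -> V => lim (k @ 0^'))); apply/funext => h /=.
case: t => x y /=; congr (_ *: (f _ - _)).
by apply: injective_projections; rewrite //= scaler0 add0r.
Qed.

Lemma partial1E (R : realType) (V : normedModType R) (f : R * R -> V) t :
  partial 1 f t = 'D_1 (fun y : R => f (t.1, y)) t.2.
Proof.
rewrite /partial /basis2 /= /derive.
apply: (congr1 (fun k : R -> V => lim (k @ 0^'))); apply/funext => h /=.
case: t => x y /=; congr (_ *: (f _ - _)).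
by apply: injective_projections; rewrite //= scaler0 add0r.
Qed.

Lemma partial0_prod (R : realType) (f g : R -> R) t : exp_trig f ->
  partial 0 (fun u => f u.1 * g u.2) t = derive1 f t.1 * g t.2.
Proof.
move=> /exp_trig_derive1[_ df]; rewrite partial0E /=.
have h := df t.1.
have : is_derive t.1 1 (fun x => f x * g t.2) (derive1 f t.1 * g t.2).
  by apply: is_derive_eq; rewrite /GRing.scale/= mulr0 add0r mulrC.
by move=> ?; exact: derive_val.
Qed.

Lemma partial1_prod (R : realType) (f g : R -> R) t : exp_trig g ->
  partial 1 (fun u => f u.1 * g u.2) t = f t.1 * derive1 g t.2.
Proof.
move=> /exp_trig_derive1[_ dg]; rewrite partial1E /=.
have h := dg t.2.
have : is_derive t.2 1 (fun x => f t.1 * g x) (f t.1 * derive1 g t.2).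
  by apply: is_derive_eq.
by move=> ?; exact: derive_val.
Qed.

Lemma exp_trig2_differentiable (R : realType) (f : R * R -> R) :
  exp_trig2 f -> forall t, differentiable f t.
Proof.
have d1 (g : R -> R) : exp_trig g -> forall t, differentiable g t.
  by move=> /exp_trig_derive1[_ dg] t; apply/derivable1_diffP; case: (dg t).
elim=> [g eg t|g eg t|{}f g _ df _ dg t|{}f g _ df _ dg t].
- apply: (@differentiable_comp _ _ _ _ fst g); last exact: d1.
  by apply: linear_differentiable => x; exact: cvg_fst.
- apply: (@differentiable_comp _ _ _ _ snd g); last exact: d1.
  by apply: linear_differentiable => x; exact: cvg_snd.
- exact: differentiableD.
- exact: differentiableM.
Qed.

Lemma exp_trig2_partial (R : realType) (i : 'I_2) (f : R * R -> R) :
  exp_trig2 f -> exp_trig2 (partial i f).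
Proof.
have z : exp_trig2 (fun=> 0 : R) by exact: (exp_trig2_fst (exp_trig_cst 0)).
elim=> [g eg|g eg|{}f g ef IHf eg IHg|{}f g ef IHf eg IHg].
- have [eg' dg] := exp_trig_derive1 eg; elim/ord2P: i.
    suff -> : partial 0 (fun t => g t.1) = (fun t => derive1 g t.1).
      exact: exp_trig2_fst.
    by apply/funext => t; rewrite partial0E derive1E.
  suff -> : partial 1 (fun t => g t.1) = (fun=> 0) by [].
  by apply/funext => t; rewrite partial1E; exact: (derive_cst (g t.1)).
- have [eg' dg] := exp_trig_derive1 eg; elim/ord2P: i.
    suff -> : partial 0 (fun t => g t.2) = (fun=> 0) by [].
    by apply/funext => t; rewrite partial0E; exact: (derive_cst (g t.2)).
  suff -> : partial 1 (fun t => g t.2) = (fun t => derive1 g t.2).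
    exact: exp_trig2_snd.
  by apply/funext => t; rewrite partial1E derive1E.
- suff -> : partial i (fun t => f t + g t) = (fun t => partial i f t + partial i g t).
    exact: exp_trig2_add.
  apply/funext => t; rewrite /partial deriveD//; apply: diff_derivable;
    exact: exp_trig2_differentiable.
- suff -> : partial i (fun t => f t * g t) =
      (fun t => f t * partial i g t + g t * partial i f t).
    by apply: exp_trig2_add; exact: exp_trig2_mul.
  apply/funext => t; rewrite /partial deriveM//; apply: diff_derivable;
    exact: exp_trig2_differentiable.
Qed.

Lemma exp_trig2_loc_lipschitz (R : realType) (I : Type) (i j : I)
    (f : R * R -> R) :
  exp_trig2 f -> loc_lipschitz (fun x : I -> R => f (x i, x j)).
Proof.
elim=> [g eg|g eg|{}f g _ IHf _ IHg|{}f g _ IHf _ IHg].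
- exact: exp_trig_loc_lipschitz.
- exact: exp_trig_loc_lipschitz.
- exact: loc_lipschitz_add.
- exact: loc_lipschitz_mul.
Qed.

Lemma rV_differentiable (R : realType) (V : normedModType R) (n : nat)
    (f : V -> 'rV[R]_n) (t : V) :
  (forall j, differentiable (fun u => f u 0 j) t) -> differentiable f t.
Proof.
move=> H.
have -> : f = \sum_(j < n) (fun u => f u 0 j *: delta_mx 0 j).
  apply/funext => u; rewrite fct_sumE; apply/rowP => k.
  rewrite summxE (bigD1 k)//= !mxE !eqxx mulr1 big1 ?addr0// => j jk.
  by rewrite !mxE eqxx/= eq_sym (negbTE jk) mulr0.
apply: differentiable_sum => j; exact: differentiableZl.
Qed.

Definition exp_trig2_rV (R : realType) (n : nat) (f : R * R -> 'rV[R]_n) :=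
  forall j, exp_trig2 (fun t => f t 0 j).

Lemma exp_trig2_rV_differentiable (R : realType) (n : nat)
    (f : R * R -> 'rV[R]_n) :
  exp_trig2_rV f -> forall t, differentiable f t.
Proof.
by move=> H t; apply: rV_differentiable => j; exact: exp_trig2_differentiable.
Qed.

Lemma partial_coord (R : realType) (n : nat) (i : 'I_2)
    (f : R * R -> 'rV[R]_n) t j :
  exp_trig2_rV f -> partial i f t 0 j = partial i (fun u => f u 0 j) t.
Proof.
move=> H; rewrite /partial derive_mx ?mxE//.
exact/diff_derivable/exp_trig2_rV_differentiable.
Qed.

Lemma exp_trig2_rV_smooth (R : realType) (n : nat) (f : R * R -> 'rV[R]_n) :
  exp_trig2_rV f -> smooth2 f.
Proof.
move=> H s t; apply: exp_trig2_rV_differentiable.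
elim: s => //= i s IH j.
under eq_fun do rewrite partial_coord//.
exact: exp_trig2_partial.
Qed.

(** * Geodesics of product metrics *)

(* The properties of a = |sigma|^2, a1 = <sigma, sigma'>, a2 = |sigma'|^2 for a
   curve sigma that make the metric of a tensor surface complete. *)
Record metric_profile (R : realType) (a a1 a2 : R -> R) : Prop := MetricProfile {
  profile_exp_trig : [/\ exp_trig a, exp_trig a1 & exp_trig a2];
  profile_derive : forall t : R, is_derive t 1 a (2 * a1 t);
  profile_growth : exists2 m : R, 0 < m & forall t, 1 + m * `|t| <= a t;
  profile_gram : exists2 d : R, 0 < d & exists2 k : R, 0 <= k &
    forall t, d * expR (- (k * `|t|)) <= a t * a2 t - a1 t ^+ 2
}.

Lemma profile_ge1 (R : realType) (a a1 a2 : R -> R) (t : R) :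
  metric_profile a a1 a2 -> 1 <= a t.
Proof.
case=> _ _ [m m0 mP] _; apply: le_trans (mP t).
by rewrite lerDl mulr_ge0// ltW.
Qed.

Lemma profile_gram_gt0 (R : realType) (a a1 a2 : R -> R) (t : R) :
  metric_profile a a1 a2 -> 0 < a t * a2 t - a1 t ^+ 2.
Proof.
case=> _ _ _ [d d0 [k _ dP]]; apply: lt_le_trans (dP t).
by rewrite mulr_gt0// expR_gt0.
Qed.

Lemma profile_speed_gt0 (R : realType) (a a1 a2 : R -> R) (t : R) :
  metric_profile a a1 a2 -> 0 < a2 t.
Proof.
move=> h; have a_gt0 := lt_le_trans ltr01 (profile_ge1 t h).
have := profile_gram_gt0 t h; rewrite subr_gt0 => h2.
by rewrite -(pmulr_rgt0 _ a_gt0) (le_lt_trans _ h2)// sqr_ge0.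
Qed.

(** The sides differ by [a1 ^+ 2] times the Gram determinant of the second factor. The lower bound
    splits into one function of each variable, the form used for the inverse metric, the velocity
    and the volume. *)
Lemma product_det_ge (R : realType) (a a1 a2 b b1 b2 : R) :
  0 <= b * b2 - b1 ^+ 2 ->
  b * b2 * (a * a2 - a1 ^+ 2) <= (a2 * b) * (a * b2) - (a1 * b1) ^+ 2.
Proof.
move=> h; rewrite -subr_ge0.
have -> : a2 * b * (a * b2) - (a1 * b1) ^+ 2 - b * b2 * (a * a2 - a1 ^+ 2) =
  a1 ^+ 2 * (b * b2 - b1 ^+ 2) by ring.
by rewrite mulr_ge0// sqr_ge0.
Qed.

Lemma is_derive_comp (R : realType) (f df p : R -> R) (t dp : R) :
  (forall t : R, is_derive t 1 f (df t)) -> is_derive t 1 p dp ->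
  is_derive t 1 (fun s => f (p s)) (df (p t) * dp).
Proof. by move=> H dP; exact: (is_derive1_comp (H (p t)) dP). Qed.

(* A solution (p, q, u, v) of the geodesic equations, slowed down by the factor
   chi; eqA and eqB are the equations for the acceleration (A, B) after
   multiplication by the metric. *)
Section apriori.
Variables (R : realType) (a a1 a2 b b1 b2 : R -> R).
Hypotheses (ha : metric_profile a a1 a2) (hb : metric_profile b b1 b2).
Variables (chi p q u v A B : R -> R).
Hypothesis chi01 : forall t, 0 <= chi t <= 1.
Hypothesis dp : forall t : R, is_derive t 1 p (chi t * u t).
Hypothesis dq : forall t : R, is_derive t 1 q (chi t * v t).
Hypothesis du : forall t : R, is_derive t 1 u (chi t * A t).
Hypothesis dv : forall t : R, is_derive t 1 v (chi t * B t).
Hypothesis eqA : forall t,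
  a2 (p t) * b (q t) * A t + a1 (p t) * b1 (q t) * B t =
  - (2^-1 * (derive1 a2 (p t) * b (q t)) * (u t * u t)
     + a2 (p t) * derive1 b (q t) * (u t * v t)
     + (a1 (p t) * derive1 b1 (q t) - 2^-1 * (derive1 a (p t) * b2 (q t)))
       * (v t * v t)).
Hypothesis eqB : forall t,
  a1 (p t) * b1 (q t) * A t + a (p t) * b2 (q t) * B t =
  - ((derive1 a1 (p t) * b1 (q t) - 2^-1 * (a2 (p t) * derive1 b (q t)))
       * (u t * u t)
     + derive1 a (p t) * b2 (q t) * (u t * v t)
     + 2^-1 * (a (p t) * derive1 b2 (q t)) * (v t * v t)).

Let energy t := a2 (p t) * b (q t) * (u t * u t)
  + 2 * (a1 (p t) * b1 (q t) * (u t * v t)) + a (p t) * b2 (q t) * (v t * v t).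

(** The derivative is [2 * chi] times the pairing of the velocity with the residuals of [eqA] and
    [eqB], so slowing down preserves conservation. *)
Lemma energy_cst t : energy t = energy 0.
Proof.
have dE (s : R) : is_derive s 1 energy 0.
  have [/exp_trig_derive1[_ da] /exp_trig_derive1[_ da1]
    /exp_trig_derive1[_ da2]] := profile_exp_trig ha.
  have [/exp_trig_derive1[_ db] /exp_trig_derive1[_ db1]
    /exp_trig_derive1[_ db2]] := profile_exp_trig hb.
  have := is_derive_comp da (dp s); have := is_derive_comp da1 (dp s).
  have := is_derive_comp da2 (dp s); have := is_derive_comp db (dq s).
  have := is_derive_comp db1 (dq s); have := is_derive_comp db2 (dq s).
  have eA := eqA s; have eB := eqB s; have us := du s; have vs := dv s.
  move: eA eB.
  (* The compositions are made opaque, so that differentiation treats them as functions of time with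
     the derivatives just recorded. *)
  set fa := fun s => a (p s); set fa1 := fun s => a1 (p s).
  set fa2 := fun s => a2 (p s); set fb := fun s => b (q s).
  set fb1 := fun s => b1 (q s); set fb2 := fun s => b2 (q s).
  rewrite -[a (p s)]/(fa s) -[a1 (p s)]/(fa1 s) -[a2 (p s)]/(fa2 s).
  rewrite -[b (q s)]/(fb s) -[b1 (q s)]/(fb1 s) -[b2 (q s)]/(fb2 s).
  move=> eA eB h1 h2 h3 h4 h5 h6.
  change energy with (fun t => fa2 t * fb t * (u t * u t) +
    2 * (fa1 t * fb1 t * (u t * v t)) + fa t * fb2 t * (v t * v t)).
  move: h1 h2 h3 h4 h5 h6 eA eB.
  move: fa fa1 fa2 fb fb1 fb2 => fa fa1 fa2 fb fb1 fb2.
  move=> h1 h2 h3 h4 h5 h6 /eqP; rewrite -subr_eq0 => /eqP eA /eqP.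
  rewrite -subr_eq0 => /eqP eB.
  apply: is_derive_eq.
  transitivity (2 * chi s * (u s * 0 + v s * 0)); last by rewrite !mulr0 addr0 mulr0.
  rewrite -{1}eA -eB /GRing.scale/=.
  by field.
by have [t0|/ltW t0] := leP 0 t; have [c _] := is_derive_mvt dE t0;
  rewrite mul0r => /eqP; rewrite subr_eq0 => /eqP.
Qed.

Let phi t := a (p t) * b (q t).

(** Multiplied by [a * b], the energy becomes two squares weighted by the Gram determinants plus the
    square of the scalar product of Sigma with its velocity. *)
Lemma energy_ge0 t : 0 <= energy t.
Proof.
have ga := profile_gram_gt0 (p t) ha; have gb := profile_gram_gt0 (q t) hb.
have a_gt0 := lt_le_trans ltr01 (profile_ge1 (p t) ha).
have b_gt0 := lt_le_trans ltr01 (profile_ge1 (q t) hb).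
rewrite -(pmulr_rge0 _ (mulr_gt0 a_gt0 b_gt0)).
have -> : a (p t) * b (q t) * energy t =
  (b (q t) * u t) ^+ 2 * (a (p t) * a2 (p t) - a1 (p t) ^+ 2)
  + (a (p t) * v t) ^+ 2 * (b (q t) * b2 (q t) - b1 (q t) ^+ 2)
  + (a1 (p t) * b (q t) * u t + a (p t) * b1 (q t) * v t) ^+ 2.
  by rewrite /energy; ring.
by rewrite !addr_ge0 ?sqr_ge0// mulr_ge0 ?sqr_ge0// ltW.
Qed.

(** Gronwall's inequality for |Sigma|^2 along the curve. Adding the constant energy makes the
    function dominate its own derivative. *)
Lemma phi_growth t : phi t + energy 0 <= (phi 0 + energy 0) * expR `|t|.
Proof.
pose dphi s := chi s * (2 * a1 (p s) * b (q s) * u s + 2 * a (p s) * b1 (q s) * v s).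
have dPhi (s : R) : is_derive s 1 phi (dphi s).
  have := is_derive_comp (profile_derive ha) (dp s).
  have := is_derive_comp (profile_derive hb) (dq s) => h1 h2.
  apply: is_derive_eq; rewrite /dphi /GRing.scale/=; ring.
(* Cauchy-Schwarz: |d/dt |Sigma|^2| <= 2 |Sigma| |Sigma'| <= |Sigma|^2 + E *)
have bound s : `|dphi s| <= phi s + energy 0.
  have /andP[c0 c1] := chi01 s.
  have ga := profile_gram_gt0 (p s) ha; have gb := profile_gram_gt0 (q s) hb.
  have a_gt0 := lt_le_trans ltr01 (profile_ge1 (p s) ha).
  have b_gt0 := lt_le_trans ltr01 (profile_ge1 (q s) hb).
  have phi0 : 0 < phi s by rewrite mulr_gt0.
  have E0 := energy_ge0 s.
  rewrite -(energy_cst s) /dphi normrM (ger0_norm c0).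
  rewrite -[leRHS]mul1r ler_pM//.
  set w := (X in `|X|).
  (* The last square in the identity proving [energy_ge0] is a quarter of [w ^+ 2]; the other terms
     are nonnegative. *)
  have w2 : w ^+ 2 <= 4 * (phi s * energy s).
    rewrite -subr_ge0.
    have -> : 4 * (phi s * energy s) - w ^+ 2 =
      4 * ((b (q s) * u s) ^+ 2 * (a (p s) * a2 (p s) - a1 (p s) ^+ 2)
      + (a (p s) * v s) ^+ 2 * (b (q s) * b2 (q s) - b1 (q s) ^+ 2)).
      by rewrite /w /phi /energy; ring.
    by rewrite mulr_ge0// addr_ge0// mulr_ge0 ?sqr_ge0// ltW.
  have pe : 0 <= phi s + energy s by rewrite addr_ge0// ltW.
  rewrite -(@ler_pXn2r _ 2) ?nnegrE//.
  rewrite -normrX ger0_norm ?sqr_ge0// (le_trans w2)//.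
  rewrite -subr_ge0.
  have -> : (phi s + energy s) ^+ 2 - 4 * (phi s * energy s) = (phi s - energy s) ^+ 2.
    by ring.
  exact: sqr_ge0.
have grow (f df : R -> R) (s : R) : (forall t : R, is_derive t 1 f (df t)) ->
    (forall t, df t <= f t) -> 0 <= s -> f s <= f 0 * expR s.
  move=> df_ le s0.
  have dh (x : R) : is_derive x 1 (fun y => f y * expR (- y)) (expR (- x) * (df x - f x)).
    have h1 := df_ x.
    apply: is_derive_eq; rewrite /GRing.scale/=; ring.
  have [c _ e] := is_derive_mvt dh s0.
  have : f s * expR (- s) - f 0 * expR (- 0) <= 0.
    rewrite e mulr_le0_ge0 ?subr_ge0// mulr_ge0_le0 ?expR_ge0// subr_le0//.
  by rewrite oppr0 expR0 mulr1 subr_le0 expRN ler_pdivrMr ?expR_gt0.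
have dpsi (s : R) : is_derive s 1 (fun s => phi s + energy 0) (dphi s).
  by have := dPhi s => h; apply: is_derive_eq; rewrite addr0.
have [t0|t0] := leP 0 t.
  rewrite (ger0_norm t0).
  apply: (grow (fun s => phi s + energy 0) dphi) => // s.
  exact: le_trans (ler_norm _) (bound s).
rewrite (ltr0_norm t0).
have := grow (fun s => phi (- s) + energy 0) (fun s => - dphi (- s)) (- t)
  (is_derive_reflect dpsi).
rewrite opprK oppr0; apply; last by rewrite oppr_ge0 ltW.
by move=> s; rewrite (le_trans (ler_norm _))// normrN bound.
Qed.

(** Completing the square in [v] gives [u ^+ 2 * det <= energy * (a * b2)]. By [product_det_ge] the
    factor [b2] cancels, and [b >= 1] is dropped on the left and inserted on the right. *)
Lemma velocity_bound t : u t ^+ 2 * (a (p t) * a2 (p t) - a1 (p t) ^+ 2) <=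
  energy 0 * phi t.
Proof.
have ga := profile_gram_gt0 (p t) ha; have gb := profile_gram_gt0 (q t) hb.
have a_ge1 := profile_ge1 (p t) ha; have b_ge1 := profile_ge1 (q t) hb.
have a_gt0 := lt_le_trans ltr01 a_ge1; have b_gt0 := lt_le_trans ltr01 b_ge1.
have b2_gt0 := profile_speed_gt0 (q t) hb.
have E0 := energy_ge0 t; rewrite -(energy_cst t).
have := product_det_ge (a (p t)) (a1 (p t)) (a2 (p t)) (ltW gb).
set det := (X in _ <= X) => detP.
have h : u t ^+ 2 * det <= energy t * (a (p t) * b2 (q t)).
  rewrite -subr_ge0.
  have -> : energy t * (a (p t) * b2 (q t)) - u t ^+ 2 * det =
    (a1 (p t) * b1 (q t) * u t + a (p t) * b2 (q t) * v t) ^+ 2.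
    by rewrite /det /energy; ring.
  exact: sqr_ge0.
rewrite /phi -(ler_pM2r b2_gt0).
apply: (@le_trans _ _ (u t ^+ 2 * det)).
  rewrite -mulrA ler_wpM2l ?sqr_ge0// (le_trans _ detP)//.
  rewrite [leRHS]mulrC; apply: ler_wpM2l; first exact: ltW.
  by rewrite ler_peMl// ltW.
rewrite (le_trans h)// -mulrA ler_wpM2l//.
by rewrite mulrAC ler_peMr// ltW// mulr_gt0.
Qed.

End apriori.

(** * Christoffel symbols and completeness of product metrics *)

Lemma invmx_ord2 (F : fieldType) (A : 'M[F]_2) :
  A 0 0 * A 1 1 - A 0 1 * A 1 0 != 0 ->
  A \in unitmx /\ forall i j, invmx A i j =
    (if i == j then A (i + 1) (i + 1) else - A i j)
      / (A 0 0 * A 1 1 - A 0 1 * A 1 0).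
Proof.
set d := (X in X != 0) => d0.
pose B : 'M[F]_2 := \matrix_(i, j)
  ((if i == j then A (i + 1) (i + 1) else - A i j) / d).
(* Addition in ['I_2] wraps around: [i + 1] is the other index, and [B] is the adjugate over the
   determinant. *)
have e11 : 1 + 1 = 0 :> 'I_2 by exact/val_inj.
have AB : A *m B = 1%:M.
  apply/matrixP; elim/ord2P; elim/ord2P; rewrite !mxE sum_ord2 !mxE /=
    ?add0r ?e11 /d; field; exact: d0.
have [uA _] := mulmx1_unit AB; split=> // i j.
have -> : invmx A = B by rewrite -[B]mul1mx -(mulVmx uA) -mulmxA AB mulmx1.
by rewrite mxE.
Qed.

(** Lowering the index cancels the inverse metric, so that the geodesic equation can be handled
    without divisions. *)
Lemma christoffel_lower (R : realType) (G : R * R -> 'M[R]_2) (l i j : 'I_2) t :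
  G t \in unitmx ->
  \sum_(k < 2) G t l k * christoffel G k i j t =
  2^-1 * (partial i (fun u => G u j l) t + partial j (fun u => G u i l) t
          - partial l (fun u => G u i j) t).
Proof.
move=> uG; rewrite /christoffel.
set X := fun l => partial i (fun u => G u j l) t + partial j (fun u => G u i l) t
          - partial l (fun u => G u i j) t.
transitivity (2^-1 * \sum_m (G t *m invmx (G t)) l m * X m).
  under eq_bigr do rewrite mulrCA mulr_sumr; rewrite -mulr_sumr exchange_big/=.
  congr (_ * _); apply: eq_bigr => m _.
  by rewrite mxE mulr_suml; apply: eq_bigr => k _; rewrite mulrA.
rewrite mulmxV// (bigD1 l)//= big1 ?addr0 => [|m ml].
  by rewrite mxE eqxx mul1r.
by rewrite mxE eq_sym (negbTE ml) mul0r.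
Qed.

Section product_metric.
Variables (R : realType) (a a1 a2 b b1 b2 : R -> R) (G : R * R -> 'M[R]_2).
Hypotheses (ha : metric_profile a a1 a2) (hb : metric_profile b b1 b2).
Hypothesis G00 : forall t, G t 0 0 = a2 t.1 * b t.2.
Hypothesis G01 : forall t, G t 0 1 = a1 t.1 * b1 t.2.
Hypothesis G10 : forall t, G t 1 0 = a1 t.1 * b1 t.2.
Hypothesis G11 : forall t, G t 1 1 = a t.1 * b2 t.2.

Lemma metric_det_ge t :
  b t.2 * b2 t.2 * (a t.1 * a2 t.1 - a1 t.1 ^+ 2) <=
  G t 0 0 * G t 1 1 - G t 0 1 * G t 1 0.
Proof.
rewrite G00 G11 G01 G10 -expr2; apply: product_det_ge.
exact/ltW/(profile_gram_gt0 _ hb).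
Qed.

Lemma metric_det_gt0 t : 0 < G t 0 0 * G t 1 1 - G t 0 1 * G t 1 0.
Proof.
apply: lt_le_trans (metric_det_ge t); rewrite mulr_gt0 ?(profile_gram_gt0 _ ha)//.
by rewrite mulr_gt0 ?(profile_speed_gt0 _ hb)// (lt_le_trans ltr01 (profile_ge1 _ hb)).
Qed.

Lemma metric_exp_trig2 i j : exp_trig2 (fun t => G t i j).
Proof.
have [ea ea1 ea2] := profile_exp_trig ha; have [eb eb1 eb2] := profile_exp_trig hb.
move: i j; elim/ord2P; elim/ord2P.
- under eq_fun do rewrite G00.
  by apply: exp_trig2_mul; [exact: exp_trig2_fst|exact: exp_trig2_snd].
- under eq_fun do rewrite G01.
  by apply: exp_trig2_mul; [exact: exp_trig2_fst|exact: exp_trig2_snd].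
- under eq_fun do rewrite G10.
  by apply: exp_trig2_mul; [exact: exp_trig2_fst|exact: exp_trig2_snd].
- under eq_fun do rewrite G11.
  by apply: exp_trig2_mul; [exact: exp_trig2_fst|exact: exp_trig2_snd].
Qed.

Lemma christoffel_loc_lipschitz (I : Type) (o1 o2 : I) k i j :
  loc_lipschitz (fun x : I -> R => christoffel G k i j (x o1, x o2)).
Proof.
have lG i' j' : loc_lipschitz (fun x : I -> R => G (x o1, x o2) i' j').
  exact: (exp_trig2_loc_lipschitz _ _ (metric_exp_trig2 i' j')).
have lP l i' j' :
    loc_lipschitz (fun x : I -> R => partial l (fun u => G u i' j') (x o1, x o2)).
  apply: (exp_trig2_loc_lipschitz _ _ (exp_trig2_partial _ (metric_exp_trig2 i' j'))).
have lN (g : (I -> R) -> R) : loc_lipschitz g -> loc_lipschitz (fun x => - g x).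
  move=> lg; under eq_fun do rewrite -mulN1r.
  by apply: loc_lipschitz_mul => //; exact: loc_lipschitz_cst.
have ldet : loc_lipschitz (fun x : I -> R =>
    (G (x o1, x o2) 0 0 * G (x o1, x o2) 1 1
     - G (x o1, x o2) 0 1 * G (x o1, x o2) 1 0)^-1).
  apply: loc_lipschitz_inv.
    by apply: loc_lipschitz_add; [|apply: lN]; exact: loc_lipschitz_mul.
  move=> M; have [_ _ _ [d d0 [k1 k10 dP]]] := ha.
  have [_ _ _ [e e0 [k2 k20 eP]]] := hb.
  (* Both Gram bounds at the worst point of the ball; the first applies to [b * b2], which is at
     least the Gram determinant. *)
  exists (e * expR (- (k2 * M)) * (d * expR (- (k1 * M)))) => [|x xM].
    by rewrite !mulr_gt0 ?expR_gt0.
  apply: le_trans (metric_det_ge _) => /=.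
  apply: ler_pM.
  - by rewrite mulr_ge0 ?expR_ge0// ltW.
  - by rewrite mulr_ge0 ?expR_ge0// ltW.
  - have h := eP (x o2); rewrite (le_trans _ (le_trans h _))//.
      by rewrite ler_pM2l// ler_expR lerN2 ler_wpM2l.
    by rewrite gerBl sqr_ge0.
  - rewrite (le_trans _ (dP (x o1)))//.
    by rewrite ler_pM2l// ler_expR lerN2 ler_wpM2l.
rewrite /christoffel.
apply: loc_lipschitz_mul; first exact: loc_lipschitz_cst.
apply: loc_lipschitz_sum => l; apply: loc_lipschitz_mul.
  have -> : (fun x : I -> R => invmx (G (x o1, x o2)) k l) = (fun x : I -> R =>
    (if k == l then G (x o1, x o2) (k + 1) (k + 1) else - G (x o1, x o2) k l)
    * (G (x o1, x o2) 0 0 * G (x o1, x o2) 1 1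
     - G (x o1, x o2) 0 1 * G (x o1, x o2) 1 0)^-1).
    apply/funext => x; have := metric_det_gt0 (x o1, x o2).
    by move=> /lt0r_neq0/invmx_ord2[_ ->].
  by apply: loc_lipschitz_mul => //; case: (k == l); [exact: lG|exact: lN].
apply: loc_lipschitz_add; last exact: lN.
exact: loc_lipschitz_add.
Qed.

Definition acceleration (x w : R * R) (k : 'I_2) : R :=
  - \sum_(i < 2) \sum_(j < 2) christoffel G k i j x * coord2 i w * coord2 j w.

Lemma partial_metric t :
  [/\ partial 0 (fun u => G u 0 0) t = derive1 a2 t.1 * b t.2,
      partial 1 (fun u => G u 0 0) t = a2 t.1 * derive1 b t.2,
      (partial 0 (fun u => G u 0 1) t = derive1 a1 t.1 * b1 t.2) *
      (partial 0 (fun u => G u 1 0) t = derive1 a1 t.1 * b1 t.2),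
      (partial 1 (fun u => G u 0 1) t = a1 t.1 * derive1 b1 t.2) *
      (partial 1 (fun u => G u 1 0) t = a1 t.1 * derive1 b1 t.2)
    & (partial 0 (fun u => G u 1 1) t = derive1 a t.1 * b2 t.2) *
      (partial 1 (fun u => G u 1 1) t = a t.1 * derive1 b2 t.2)].
Proof.
have [ea ea1 ea2] := profile_exp_trig ha; have [eb eb1 eb2] := profile_exp_trig hb.
rewrite (funext G00) (funext G01) (funext G10) (funext G11).
by split; rewrite ?partial0_prod ?partial1_prod.
Qed.

(** Takes exactly the shape of the hypotheses [eqA] and [eqB] of the a priori estimates. *)
Lemma acceleration_lower x w :
  a2 x.1 * b x.2 * acceleration x w 0 + a1 x.1 * b1 x.2 * acceleration x w 1 =
  - (2^-1 * (derive1 a2 x.1 * b x.2) * (w.1 * w.1)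
     + a2 x.1 * derive1 b x.2 * (w.1 * w.2)
     + (a1 x.1 * derive1 b1 x.2 - 2^-1 * (derive1 a x.1 * b2 x.2))
       * (w.2 * w.2)) /\
  a1 x.1 * b1 x.2 * acceleration x w 0 + a x.1 * b2 x.2 * acceleration x w 1 =
  - ((derive1 a1 x.1 * b1 x.2 - 2^-1 * (a2 x.1 * derive1 b x.2))
       * (w.1 * w.1)
     + derive1 a x.1 * b2 x.2 * (w.1 * w.2)
     + 2^-1 * (a x.1 * derive1 b2 x.2) * (w.2 * w.2)).
Proof.
have [uG _] := invmx_ord2 (lt0r_neq0 (metric_det_gt0 x)).
have C l i j := christoffel_lower l i j uG.
have [p00 p10 [p001 p010] [p101 p110] [p011 p111]] := partial_metric x.
split.
- have := C 0 0 0; have := C 0 0 1; have := C 0 1 0; have := C 0 1 1.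
  rewrite !sum_ord2 /acceleration !sum_ord2 /coord2 /= G00 G01.
  rewrite ?p00 ?p10 ?p001 ?p010 ?p101 ?p110 ?p011 ?p111 => h1 h2 h3 h4.
  move: h1 h2 h3 h4.
  move: (christoffel G) => Gamma h1 h2 h3 h4.
  transitivity (- (
    (a2 x.1 * b x.2 * Gamma 0 0 0 x + a1 x.1 * b1 x.2 * Gamma 1 0 0 x) * (w.1 * w.1)
   + (a2 x.1 * b x.2 * Gamma 0 0 1 x + a1 x.1 * b1 x.2 * Gamma 1 0 1 x) * (w.1 * w.2)
   + (a2 x.1 * b x.2 * Gamma 0 1 0 x + a1 x.1 * b1 x.2 * Gamma 1 1 0 x) * (w.1 * w.2)
   + (a2 x.1 * b x.2 * Gamma 0 1 1 x + a1 x.1 * b1 x.2 * Gamma 1 1 1 x) * (w.2 * w.2))).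
    by ring.
  by rewrite h1 h2 h3 h4; field.
- have := C 1 0 0; have := C 1 0 1; have := C 1 1 0; have := C 1 1 1.
  rewrite !sum_ord2 /acceleration !sum_ord2 /coord2 /= G10 G11.
  rewrite ?p00 ?p10 ?p001 ?p010 ?p101 ?p110 ?p011 ?p111 => h1 h2 h3 h4.
  move: h1 h2 h3 h4.
  move: (christoffel G) => Gamma h1 h2 h3 h4.
  transitivity (- (
    (a1 x.1 * b1 x.2 * Gamma 0 0 0 x + a x.1 * b2 x.2 * Gamma 1 0 0 x) * (w.1 * w.1)
   + (a1 x.1 * b1 x.2 * Gamma 0 0 1 x + a x.1 * b2 x.2 * Gamma 1 0 1 x) * (w.1 * w.2)
   + (a1 x.1 * b1 x.2 * Gamma 0 1 0 x + a x.1 * b2 x.2 * Gamma 1 1 0 x) * (w.1 * w.2)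
   + (a1 x.1 * b1 x.2 * Gamma 0 1 1 x + a x.1 * b2 x.2 * Gamma 1 1 1 x) * (w.2 * w.2))).
    by ring.
  by rewrite h1 h2 h3 h4; field.
Qed.

Theorem product_metric_complete : geodesically_complete G.
Proof.
move=> x0 w0.
(* In the first-order system, coordinates 0 and 1 are the position, 2 and 3 the velocity. *)
pose o0 := @Ordinal 4 0 isT; pose o1 := @Ordinal 4 1 isT.
pose o2 := @Ordinal 4 2 isT; pose o3 := @Ordinal 4 3 isT.
pose F (x : 'I_4 -> R) (k : 'I_4) : R :=
  match val k with
  | 0%N => x o2 | 1%N => x o3
  | 2%N => acceleration (x o0, x o1) (x o2, x o3) 0
  | _ => acceleration (x o0, x o1) (x o2, x o3) 1
  end.
pose y0 (k : 'I_4) : R :=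
  match val k with 0%N => x0.1 | 1%N => x0.2 | 2%N => w0.1 | _ => w0.2 end.
pose E0 := a2 x0.1 * b x0.2 * (w0.1 * w0.1)
  + 2 * (a1 x0.1 * b1 x0.2 * (w0.1 * w0.2)) + a x0.1 * b2 x0.2 * (w0.2 * w0.2).
pose Phi (t : R) := (a x0.1 * b x0.2 + E0) * expR `|t|.
have [_ _ [m m0 mP] [d d0 [k k0 dP]]] := ha.
have [_ _ [n n0 nP] [e e0 [l l0 eP]]] := hb.
(* Linear growth confines the position to [Phi t / r], where the Gram determinant is at least
   [s * expR (- (c * (Phi t / r)))]. Then [velocity_bound] bounds [z ^+ 2], and [|z| <= 1 + z ^+ 2]
   avoids a square root. *)
pose V (c r s t : R) := 1 + E0 * Phi t * expR (c * (Phi t / r)) / s.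
(* One function must bound all four coordinates, so the four nonnegative bounds are added. *)
pose M (t : R) := Phi t / m + Phi t / n + V k m d t + V l n e t.
have [|||y [y00 dy]] := @global_solution R 4 F y0 M.
- have lacc j : loc_lipschitz (fun x : 'I_4 -> R =>
      acceleration (x o0, x o1) (x o2, x o3) j).
    rewrite /acceleration; under eq_fun do rewrite -mulN1r.
    apply: loc_lipschitz_mul; first exact: loc_lipschitz_cst.
    apply: loc_lipschitz_sum => i'; apply: loc_lipschitz_sum => j'.
    have lw : forall i, loc_lipschitz (fun x : 'I_4 -> R => coord2 i (x o2, x o3)).
      by elim/ord2P; exact: loc_lipschitz_coord.
    apply: loc_lipschitz_mul => //; apply: loc_lipschitz_mul => //.
    exact: christoffel_loc_lipschitz.
  move=> [[|[|[|i]]] i4]; rewrite /F /=; try exact: loc_lipschitz_coord.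
  - exact: lacc.
  - exact: lacc.
- have cadd (f g : R -> R) : continuous f -> continuous g ->
      continuous (fun t => f t + g t).
    by move=> cf cg t; apply: (@cvgD _ R^o); [exact: cf|exact: cg].
  have cmul (f g : R -> R) : continuous f -> continuous g ->
      continuous (fun t => f t * g t).
    by move=> cf cg t; apply: cvgM; [exact: cf|exact: cg].
  have ccst (c : R) : continuous (fun _ : R => c) by move=> t; exact: cvg_cst.
  have cexp (f : R -> R) : continuous f -> continuous (fun t => expR (f t)).
    move=> cf t; apply: (@continuous_comp _ _ _ f expR); first exact: cf.
    exact: continuous_expR.
  have cPhi : continuous Phi.
    by apply: (cmul _ _) => //; apply: (cexp _) => t; exact: (@norm_continuous _ R^o).
  have cV c r s : continuous (V c r s).
    apply: (cadd _ _) => //; apply: (cmul _ _) => //; apply: (cmul _ _); first exact: (cmul _ _).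
    by apply: (cexp _); apply: (cmul _ _) => //; exact: (cmul _ _).
  apply: (cadd _ _) => //; apply: (cadd _ _) => //.
  by apply: (cadd _ _); exact: (cmul _ _).
- move=> chi y chi01 y00 dy t.
  have dp := dy o0; have dq := dy o1; have du := dy o2; have dv := dy o3.
  rewrite /F /= in dp dq du dv.
  have eqA s := (acceleration_lower (y s o0, y s o1) (y s o2, y s o3)).1.
  have eqB s := (acceleration_lower (y s o0, y s o1) (y s o2, y s o3)).2.
  rewrite /= in eqA eqB.
  have E_ge0 : 0 <= E0 by have := energy_ge0 ha hb (fun s => y s o0) (fun s => y s o1)
    (fun s => y s o2) (fun s => y s o3) 0; rewrite /= y00.
  have growth := phi_growth ha hb chi01 dp dq du dv eqA eqB t.
  rewrite /= y00 -/E0 -/(Phi t) in growth.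
  have bu := velocity_bound ha hb dp dq du dv eqA eqB t.
  rewrite /= y00 -/E0 in bu.
  (* The system is symmetric in the two factors: with their roles exchanged, [velocity_bound]
     controls the second component. *)
  have eqA' s : b2 (y s o1) * a (y s o0) * acceleration (y s o0, y s o1) (y s o2, y s o3) 1
    + b1 (y s o1) * a1 (y s o0) * acceleration (y s o0, y s o1) (y s o2, y s o3) 0 =
    - (2^-1 * (derive1 b2 (y s o1) * a (y s o0)) * (y s o3 * y s o3)
     + b2 (y s o1) * derive1 a (y s o0) * (y s o3 * y s o2)
     + (b1 (y s o1) * derive1 a1 (y s o0) - 2^-1 * (derive1 b (y s o1) * a2 (y s o0)))
       * (y s o2 * y s o2)).
    by have := eqB s; lra.
  have eqB' s : b1 (y s o1) * a1 (y s o0) * acceleration (y s o0, y s o1) (y s o2, y s o3) 1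
    + b (y s o1) * a2 (y s o0) * acceleration (y s o0, y s o1) (y s o2, y s o3) 0 =
    - ((derive1 b1 (y s o1) * a1 (y s o0) - 2^-1 * (b2 (y s o1) * derive1 a (y s o0)))
       * (y s o3 * y s o3)
     + derive1 b (y s o1) * a2 (y s o0) * (y s o3 * y s o2)
     + 2^-1 * (b (y s o1) * derive1 a2 (y s o0)) * (y s o2 * y s o2)).
    by have := eqA s; lra.
  have bv := velocity_bound hb ha dq dp dv du eqA' eqB' t.
  rewrite /= y00 [b _ * a _]mulrC in bv.
  have a_ge1 := profile_ge1 (y t o0) ha; have b_ge1 := profile_ge1 (y t o1) hb.
  have ab : a (y t o0) * b (y t o1) <= Phi t by rewrite (le_trans _ growth)// lerDl.
  have aPhi : a (y t o0) <= Phi t.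
    by rewrite (le_trans _ ab)// ler_peMr// (le_trans ler01).
  have bPhi : b (y t o1) <= Phi t.
    by rewrite (le_trans _ ab)// ler_peMl// (le_trans ler01).
  have Phi0 : 0 <= Phi t by rewrite (le_trans _ aPhi)// (le_trans ler01).
  have pos_bound (r : R) (f : R -> R) (x : R) : 0 < r -> 1 + r * `|x| <= f x -> f x <= Phi t ->
      `|x| <= Phi t / r.
    move=> r0 h1 h2; rewrite ler_pdivlMr// mulrC (le_trans _ h2)// (le_trans _ h1)//.
    by rewrite lerDr.
  have bp := pos_bound m a (y t o0) m0 (mP _) aPhi.
  have bq := pos_bound n b (y t o1) n0 (nP _) bPhi.
  have vel_bound (c r s x z g : R) : 0 < s -> 0 <= c -> `|x| <= Phi t / r ->
      s * expR (- (c * `|x|)) <= g -> z ^+ 2 * g <= E0 * Phi t -> `|z| <= V c r s t.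
    move=> s0 c0 xr sg zg.
    have h : z ^+ 2 <= E0 * Phi t * expR (c * (Phi t / r)) / s.
      rewrite ler_pdivlMr// -[leRHS]mulrA.
      have h1 : z ^+ 2 * (s * expR (- (c * `|x|))) <= E0 * Phi t.
        by rewrite (le_trans _ zg)// ler_wpM2l// sqr_ge0.
      have h2 : z ^+ 2 * s <= E0 * Phi t * expR (c * `|x|).
        by rewrite -ler_pdivrMr ?expR_gt0// -expRN -mulrA.
      rewrite (le_trans h2)// mulrA; apply: ler_wpM2l; first exact: mulr_ge0.
      by rewrite ler_expR ler_wpM2l.
    rewrite (le_trans _ (lerD (lexx 1) h))// -real_normK ?num_real//.
    have := sqr_ge0 (`|z| - 1); rewrite sqrrB1 => h3.
    by have := sqr_ge0 `|z|; move: h3; lra.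
  have bu' : `|y t o2| <= V k m d t.
    apply: (vel_bound k m d (y t o0)) (dP _) _ => //.
    by rewrite (le_trans bu)// ler_wpM2l.
  have bv' : `|y t o3| <= V l n e t.
    apply: (vel_bound l n e (y t o1)) (eP _) _ => //.
    rewrite (le_trans bv)//.
    have -> : b2 x0.2 * a x0.1 * (w0.2 * w0.2) +
      2 * (b1 x0.2 * a1 x0.1 * (w0.2 * w0.1)) + b x0.2 * a2 x0.1 * (w0.1 * w0.1) = E0.
      by rewrite /E0; ring.
    by rewrite ler_wpM2l.
  have np := le_trans (normr_ge0 _) bp; have nq := le_trans (normr_ge0 _) bq.
  have nu := le_trans (normr_ge0 _) bu'; have nv := le_trans (normr_ge0 _) bv'.
  move=> [[|[|[|[|//]]]] i4]; rewrite /M.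
  - rewrite (_ : Ordinal i4 = o0); last exact/val_inj.
    by lra.
  - rewrite (_ : Ordinal i4 = o1); last exact/val_inj.
    by lra.
  - rewrite (_ : Ordinal i4 = o2); last exact/val_inj.
    by lra.
  - rewrite (_ : Ordinal i4 = o3); last exact/val_inj.
    by lra.
exists (fun s => (y s o0, y s o1)).
have dp := dy o0; have dq := dy o1; have du := dy o2; have dv := dy o3.
rewrite /F /= in dp dq du dv.
have dpE : derive1 (fun s => y s o0) = (fun s => y s o2).
  by apply/funext => s; exact: is_derive_derive1.
have dqE : derive1 (fun s => y s o1) = (fun s => y s o3).
  by apply/funext => s; exact: is_derive_derive1.
have c0 : (fun s => coord2 0 (y s o0, y s o1)) = (fun s => y s o0) by [].
have c1 : (fun s => coord2 1 (y s o0, y s o1)) = (fun s => y s o1) by [].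
split.
- have cE i s : derive1 (fun s => coord2 i (y s o0, y s o1)) s = coord2 i (y s o2, y s o3).
    by move: i; elim/ord2P; rewrite ?c0 ?c1 ?dpE ?dqE.
  move=> /= k' s.
  under eq_bigr do under eq_bigr do rewrite !cE.
  move: k'; elim/ord2P; rewrite ?c0 ?c1 ?dpE ?dqE.
  + split; [by case: (dp s)|by case: (du s)|].
    by rewrite (is_derive_derive1 (du s)) /acceleration addNr.
  + split; [by case: (dq s)|by case: (dv s)|].
    by rewrite (is_derive_derive1 (dv s)) /acceleration addNr.
- by rewrite y00 /y0 /= -surjective_pairing.
- by elim/ord2P; rewrite ?c0 ?c1 ?dpE ?dqE y00.
Qed.

End product_metric.

(** * Tensor surfaces *)

Lemma dotrvC (R : realType) (n : nat) (u v : 'rV[R]_n) : dotrv u v = dotrv v u.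
Proof. by apply: eq_bigr => i _; rewrite mulrC. Qed.

Lemma dotrv_tens (R : realType) (m n : nat) (u u' : 'rV[R]_m) (v v' : 'rV[R]_n) :
  dotrv (u *t v : 'rV_(m * n)) (u' *t v') = dotrv u u' * dotrv v v'.
Proof.
rewrite /dotrv mulr_sum; apply: eq_bigr => k _.
by rewrite !mxE !ord1 mulrACA.
Qed.

Lemma tens_rV_coord (R : realType) (m n : nat) (u : 'rV[R]_m) (v : 'rV[R]_n) k l :
  (u *t v : 'rV_(m * n)) 0 (mxtens_index (k, l)) = u 0 k * v 0 l.
Proof. by rewrite mxE mxtens_indexK !ord1. Qed.

(* One term of Lagrange's identity *)
Lemma dotrv_gram_ge (R : realType) (n : nat) (u v : 'rV[R]_n) i j :
  2^-1 * (u 0 i * v 0 j - u 0 j * v 0 i) ^+ 2 <=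
  dotrv u u * dotrv v v - dotrv u v ^+ 2.
Proof.
rewrite ler_pdivrMl//.
have -> : 2 * (dotrv u u * dotrv v v - dotrv u v ^+ 2) =
    \sum_k \sum_l (u 0 k * v 0 l - u 0 l * v 0 k) ^+ 2.
  have -> : \sum_k \sum_l (u 0 k * v 0 l - u 0 l * v 0 k) ^+ 2 =
      \sum_k \sum_l (u 0 k * u 0 k * (v 0 l * v 0 l)
        - 2 * (u 0 k * v 0 k * (u 0 l * v 0 l)) + v 0 k * v 0 k * (u 0 l * u 0 l)).
    by apply: eq_bigr => k _; apply: eq_bigr => l _; ring.
  under [RHS]eq_bigr do rewrite big_split /= sumrB -!mulr_sumr.
  rewrite big_split /= sumrB -!mulr_suml -mulr_sumr -mulr_suml.
  by rewrite /dotrv; ring.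
rewrite (bigD1 i)//= (bigD1 j)//= -addrA lerDl addr_ge0//.
  by apply: sumr_ge0 => l _; exact: sqr_ge0.
by apply: sumr_ge0 => k _; apply: sumr_ge0 => l _; exact: sqr_ge0.
Qed.

Lemma dotrv_sqr_ge (R : realType) (n : nat) (u : 'rV[R]_n) i :
  u 0 i ^+ 2 <= dotrv u u.
Proof.
rewrite /dotrv (bigD1 i)//= expr2 lerDl.
by apply: sumr_ge0 => l _; rewrite -expr2 sqr_ge0.
Qed.

Definition exp_trig_rV (R : realType) (n : nat) (sigma : R -> 'rV[R]_n) : Prop :=
  forall i, exp_trig (fun t => sigma t 0 i).

Definition velocity (R : realType) (n : nat) (sigma : R -> 'rV[R]_n) (t : R)
    : 'rV[R]_n :=
  \row_i derive1 (fun s => sigma s 0 i) t.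

Lemma exp_trig_rV_velocity (R : realType) (n : nat) (sigma : R -> 'rV[R]_n) :
  exp_trig_rV sigma -> exp_trig_rV (velocity sigma).
Proof.
by move=> H i; under eq_fun do rewrite mxE; case: (exp_trig_derive1 (H i)).
Qed.

Lemma exp_trig_dotrv (R : realType) (n : nat) (sigma tau : R -> 'rV[R]_n) :
  exp_trig_rV sigma -> exp_trig_rV tau ->
  exp_trig (fun t => dotrv (sigma t) (tau t)).
Proof. by move=> H H'; apply: exp_trig_sum => j; exact: exp_trig_mul. Qed.

Lemma is_derive_dotrv (R : realType) (n : nat) (sigma : R -> 'rV[R]_n) (t : R) :
  exp_trig_rV sigma ->
  is_derive t 1 (fun t => dotrv (sigma t) (sigma t))
    (2 * dotrv (sigma t) (velocity sigma t)).
Proof.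
move=> H; pose f i (s : R) := sigma s 0 i * sigma s 0 i.
have df i : is_derive t 1 (f i) (2 * (sigma t 0 i * velocity sigma t 0 i)).
  have [_ /(_ t) h] := exp_trig_derive1 (H i).
  by apply: (is_derive_eq (is_deriveM h h)); rewrite /GRing.scale/= mxE; ring.
have := is_derive_sum (fun i => df i); rewrite -mulr_sumr.
by rewrite (_ : \sum_i f i = (fun t => dotrv (sigma t) (sigma t)))//;
  apply/funext => s; rewrite fct_sumE.
Qed.

Lemma expRsqr (R : realType) (x : R) : expR x ^+ 2 = expR (2 * x).
Proof. by rewrite expr2 -expRD; congr expR; ring. Qed.

Lemma derive1_expR_lin (R : realType) (r t : R) :
  derive1 (fun s => expR (r * s)) t = expR (r * t) * r.
Proof.
apply: is_derive_derive1.
have lin : is_derive t 1 (fun t => r * t) r.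
  by apply: is_derive_eq; rewrite /GRing.scale/= mulr1.
exact: (is_derive1_comp (is_derive_expR (r * t)) lin).
Qed.

Section curve.
Variables (R : realType) (n : nat) (sigma : R -> 'rV[R]_n).
Hypothesis esigma : exp_trig_rV sigma.
Variables (i j : 'I_n) (r q : R).
Hypotheses (r0 : 0 < r) (q0 : q < 0).
Hypothesis coord_i : forall t, sigma t 0 i = expR (r * t).
Hypothesis coord_j : forall t, sigma t 0 j = expR (q * t).

Lemma velocity_coord k (c : R) : (forall t, sigma t 0 k = expR (c * t)) ->
  forall t, velocity sigma t 0 k = expR (c * t) * c.
Proof. by move=> H t; rewrite mxE (funext H) derive1_expR_lin. Qed.

(** Growth comes from [expR x >= 1 + x], applied to coordinate [i] at positive and [j] at negative
    times. The minor of position and velocity in coordinates [i] and [j] is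
    [(q - r) * expR ((r + q) * t)], which never vanishes. *)
Lemma curve_profile :
  metric_profile (fun t => dotrv (sigma t) (sigma t))
    (fun t => dotrv (sigma t) (velocity sigma t))
    (fun t => dotrv (velocity sigma t) (velocity sigma t)).
Proof.
have ev := exp_trig_rV_velocity esigma.
split.
- by split; exact: exp_trig_dotrv.
- by move=> t; exact: is_derive_dotrv.
- exists (Num.min (2 * r) (- (2 * q))) => [|t].
    by rewrite lt_min mulr_gt0//= oppr_gt0 pmulr_rlt0.
  have [t0|t0] := leP 0 t.
  + apply: le_trans (dotrv_sqr_ge _ i); rewrite coord_i expRsqr.
    rewrite (le_trans _ (expR_ge1Dx _))// lerD2l ger0_norm// mulrA ler_wpM2r//.
    by rewrite ge_min lexx.
  + apply: le_trans (dotrv_sqr_ge _ j); rewrite coord_j expRsqr.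
    rewrite (le_trans _ (expR_ge1Dx _))// lerD2l ltr0_norm// mulrA -[leRHS]mulrNN.
    apply: ler_wpM2r; first by rewrite oppr_ge0 ltW.
    by rewrite ge_min lexx orbT.
(* Half the squared minor, as in [dotrv_gram_ge]; the sign of [r + q] is unknown, hence the rate
   [2 * |r + q|]. *)
- exists (2^-1 * (r - q) ^+ 2).
    by rewrite mulr_gt0// exprn_gt0// subr_gt0 (lt_trans q0).
  exists (2 * `|r + q|) => [|t]; first by rewrite mulr_ge0.
  apply: le_trans (dotrv_gram_ge _ _ i j).
  rewrite !(velocity_coord coord_i) !(velocity_coord coord_j) coord_i coord_j.
  have -> : expR (r * t) * (expR (q * t) * q) - expR (q * t) * (expR (r * t) * r)
    = (q - r) * (expR (r * t) * expR (q * t)) by ring.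
  rewrite -expRD exprMn expRsqr -mulrA -sqrrN opprB.
  do 2?(rewrite ler_wpM2l// ?sqr_ge0//).
  rewrite ler_expR -mulrA lerNl -mulrN ler_wpM2l// -mulrDl -mulrN.
  by rewrite (le_trans (ler_norm _))// normrM normrN.
Qed.

(** As [r] is positive, the speed does not decay towards [+oo]; this fixes the unbounded direction
    of the region in the volume estimate. *)
Lemma curve_speed_ge t : 0 <= t ->
  r ^+ 2 <= dotrv (velocity sigma t) (velocity sigma t).
Proof.
move=> t0; apply: le_trans (dotrv_sqr_ge _ i).
rewrite (velocity_coord coord_i) exprMn ler_peMl ?sqr_ge0// expRsqr.
by rewrite -expR0 ler_expR !mulr_ge0// ltW.
Qed.

End curve.

Lemma tensor_surface_exp_trig2 (R : realType) (m n : nat)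
    (sigma : R -> 'rV[R]_m) (tau : R -> 'rV[R]_n) :
  exp_trig_rV sigma -> exp_trig_rV tau ->
  exp_trig2_rV (tensor_surface sigma tau).
Proof.
move=> H H' k; rewrite /tensor_surface; under eq_fun do rewrite mxE !ord1.
by apply: exp_trig2_mul; [exact: (exp_trig2_fst (H _))|exact: (exp_trig2_snd (H' _))].
Qed.

Lemma partial0_tensor (R : realType) (m n : nat)
    (sigma : R -> 'rV[R]_m) (tau : R -> 'rV[R]_n) t :
  exp_trig_rV sigma -> exp_trig_rV tau ->
  partial 0 (tensor_surface sigma tau) t = velocity sigma t.1 *t tau t.2.
Proof.
move=> H H'; apply/rowP => k.
rewrite partial_coord; last exact: tensor_surface_exp_trig2.
rewrite /tensor_surface; under eq_fun do rewrite mxE !ord1.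
by rewrite (partial0_prod (fun s => tau s 0 _) _ (H _)) mxE !ord1 mxE.
Qed.

Lemma partial1_tensor (R : realType) (m n : nat)
    (sigma : R -> 'rV[R]_m) (tau : R -> 'rV[R]_n) t :
  exp_trig_rV sigma -> exp_trig_rV tau ->
  partial 1 (tensor_surface sigma tau) t = sigma t.1 *t velocity tau t.2.
Proof.
move=> H H'; apply/rowP => k.
rewrite partial_coord; last exact: tensor_surface_exp_trig2.
rewrite /tensor_surface; under eq_fun do rewrite mxE !ord1.
by rewrite (partial1_prod (fun s => sigma s 0 _) _ (H' _)) mxE !ord1 mxE.
Qed.

Lemma exp_trig2_measurable (R : realType) (f : R * R -> R) :
  exp_trig2 f ->
  measurable_fun [set: measurableTypeR R * measurableTypeR R]
    (f : measurableTypeR R * measurableTypeR R -> measurableTypeR R).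
Proof.
elim=> [g eg|g eg|{}f g _ IHf _ IHg|{}f g _ IHf _ IHg].
- apply: (measurableT_comp _ measurable_fst).
  by apply: continuous_measurable_fun; exact: exp_trig_continuous.
- apply: (measurableT_comp _ measurable_snd).
  by apply: continuous_measurable_fun; exact: exp_trig_continuous.
- exact: measurable_funD.
- exact: measurable_funM.
Qed.

Section surface.
Variables (R : realType) (m n : nat).
Variables (sigma : R -> 'rV[R]_m) (tau : R -> 'rV[R]_n).
Hypotheses (esigma : exp_trig_rV sigma) (etau : exp_trig_rV tau).
Variables (i j : 'I_m) (k l : 'I_n) (r q s p : R).
Hypotheses (r0 : 0 < r) (q0 : q < 0) (s0 : 0 < s) (p0 : p < 0).
Hypothesis coord_i : forall t, sigma t 0 i = expR (r * t).
Hypothesis coord_j : forall t, sigma t 0 j = expR (q * t).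
Hypothesis coord_k : forall t, tau t 0 k = expR (s * t).
Hypothesis coord_l : forall t, tau t 0 l = expR (p * t).

Let Sigma := tensor_surface sigma tau.
Let a t := dotrv (sigma t) (sigma t).
Let a1 t := dotrv (sigma t) (velocity sigma t).
Let a2 t := dotrv (velocity sigma t) (velocity sigma t).
Let b t := dotrv (tau t) (tau t).
Let b1 t := dotrv (tau t) (velocity tau t).
Let b2 t := dotrv (velocity tau t) (velocity tau t).
Let ha : metric_profile a a1 a2 := curve_profile esigma r0 q0 coord_i coord_j.
Let hb : metric_profile b b1 b2 := curve_profile etau s0 p0 coord_k coord_l.

Lemma induced_metric_tensor t :
  [/\ induced_metric Sigma t 0 0 = a2 t.1 * b t.2,
      induced_metric Sigma t 0 1 = a1 t.1 * b1 t.2,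
      induced_metric Sigma t 1 0 = a1 t.1 * b1 t.2
    & induced_metric Sigma t 1 1 = a t.1 * b2 t.2].
Proof.
by split; rewrite mxE ?partial0_tensor ?partial1_tensor// dotrv_tens /a1 /b1
  ?(dotrvC (velocity _ _) (sigma _)) ?(dotrvC (velocity _ _) (tau _)).
Qed.

Lemma tensor_surface_complete : geodesically_complete (induced_metric Sigma).
Proof.
by apply: (product_metric_complete ha hb) => t; case: (induced_metric_tensor t).
Qed.

Lemma tensor_surface_volume : surface_volume Sigma = +oo%E.
Proof.
pose mu := (@lebesgue_measure R \x @lebesgue_measure R)%E.
pose D : set (measurableTypeR R * measurableTypeR R) := `[0, 1]%classic `*` `[0, +oo[%classic.
have mD : measurable D by apply: measurableX; exact: measurable_itv.
have [_ _ _ [d d0 [c c0 dP]]] := ha.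
(* On [D], [b * b2] is at least [s ^+ 2] because the second time is nonnegative, and the Gram
   determinant of [sigma] is at least [d * expR (- c)] because the first time is at most 1. *)
pose e := s ^+ 2 * (d * expR (- c)).
have e0 : 0 < e by rewrite !mulr_gt0 ?exprn_gt0 ?expR_gt0.
have dens t : D t -> Num.sqrt e <= volume_density Sigma t.
  case=> /=; rewrite !in_itv/= andbT => /andP[t0 t1] t2.
  rewrite /volume_density; have [G00 G01 G10 G11] := induced_metric_tensor t.
  apply: ler_wsqrtr; rewrite G00 G01 G11.
  apply: le_trans (product_det_ge _ _ _ _).
  - apply: ler_pM.
    + exact: sqr_ge0.
    + by rewrite mulr_ge0 ?expR_ge0// ltW.
    + have bs := curve_speed_ge s0 coord_k t2.
      rewrite (le_trans bs)// ler_peMl// ?(profile_ge1 _ hb)//.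
      exact/ltW/(profile_speed_gt0 _ hb).
    + apply: le_trans (dP t.1); rewrite ler_pM2l// ler_expR lerN2 ler_piMr//.
      by rewrite ger0_norm.
  - exact/ltW/(profile_gram_gt0 _ hb).
have mdens : measurable_fun setT (volume_density Sigma
    : measurableTypeR R * measurableTypeR R -> measurableTypeR R).
  apply: (measurableT_comp (continuous_measurable_fun (@sqrt_continuous R))).
  have [[ea ea1 ea2] _ _ _] := ha; have [[eb eb1 eb2] _ _ _] := hb.
  apply: exp_trig2_measurable.
  rewrite [X in exp_trig2 X](_ : _ = fun t => a2 t.1 * b t.2 * (a t.1 * b2 t.2)
      + -1 * ((a1 t.1 * b1 t.2) * (a1 t.1 * b1 t.2))); last first.
    apply/funext => t; have [-> -> _ ->] := induced_metric_tensor t.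
    by rewrite mulN1r expr2.
  have fst2 (f : R -> R) : exp_trig f -> exp_trig2 (fun t => f t.1).
    exact: exp_trig2_fst.
  have snd2 (f : R -> R) : exp_trig f -> exp_trig2 (fun t => f t.2).
    exact: exp_trig2_snd.
  apply: exp_trig2_add.
    by do !apply: exp_trig2_mul; do ?[exact: (fst2 _)|exact: (snd2 _)].
  apply: exp_trig2_mul; first exact: (exp_trig2_fst (exp_trig_cst (-1))).
  by do !apply: exp_trig2_mul; do ?[exact: (fst2 _)|exact: (snd2 _)].
apply/eqP; rewrite -leye_eq.
have <- : (\int[mu]_(t in D) (cst (Num.sqrt e)%:E t) = +oo)%E.
  rewrite integral_cst//.
  transitivity ((Num.sqrt e)%:E * (@lebesgue_measure R `[0%R, 1%R]%classic
      * @lebesgue_measure R `[0%R, +oo[%classic))%E.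
    by congr (_ * _)%E; apply: product_measure1E; exact: measurable_itv.
  rewrite !lebesgue_measure_itv /= lte_fin ltr01 ltry oppr0 addeC add0e mul1e.
  by rewrite gt0_muley// lte_fin sqrtr_gt0.
have /measurable_EFinP mE := mdens.
apply: (@le_trans _ _ (\int[mu]_(t in D) (volume_density Sigma t)%:E)%E).
  apply: ge0_le_integral => //.
  - by move=> t _; rewrite lee_fin sqrtr_ge0.
  - exact: measurable_funS mE.
apply: ge0_subset_integral => //.
by move=> t _; rewrite lee_fin sqrtr_ge0.
Qed.

(** After division by exponentials, coordinates [(i, k)] and [(j, k)] of a kernel vector give a
    linear system with determinant [(r - q) * s], which is not 0. *)
Lemma tensor_surface_immersion : immersion2 Sigma.
Proof.
move=> t; have dS := exp_trig2_rV_differentiable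
  (tensor_surface_exp_trig2 esigma etau) t.
have dE (z : R * R) : 'd Sigma t z =
    z.1 *: partial 0 Sigma t + z.2 *: partial 1 Sigma t.
  rewrite /partial !deriveE// /basis2 /= -!linearZ -linearD /=.
  by congr ('d Sigma t _); apply: injective_projections;
    rewrite /= ?scaler0 ?add0r ?addr0 /GRing.scale/= mulr1.
have ker (z : R * R) : 'd Sigma t z = 0 -> z = 0.
  rewrite dE partial0_tensor// partial1_tensor// => /rowP z0.
  have := z0 (mxtens_index (i, k)); have := z0 (mxtens_index (j, k)).
  have c (x y : R) (u u' : 'rV[R]_m) (v v' : 'rV[R]_n) i' k' :
      (x *: (u *t v : 'rV_(m * n)) + y *: (u' *t v' : 'rV_(m * n))) 0 (mxtens_index (i', k'))
      = x * (u 0 i' * v 0 k') + y * (u' 0 i' * v' 0 k').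
    by rewrite mxE [X in X + _]mxE [X in _ + X]mxE !tens_rV_coord.
  rewrite !c !(velocity_coord coord_i) !(velocity_coord coord_j)
    !(velocity_coord coord_k) coord_i coord_j coord_k !mxE.
  set ei := expR (r * t.1); set ej := expR (q * t.1); set ek := expR (s * t.2).
  have ei0 : ei != 0 by rewrite gt_eqF// expR_gt0.
  have ej0 : ej != 0 by rewrite gt_eqF// expR_gt0.
  have ek0 : ek != 0 by rewrite gt_eqF// expR_gt0.
  have -> : z.1 * (ej * q * ek) + z.2 * (ej * (ek * s)) =
    (ej * ek) * (z.1 * q + z.2 * s) by ring.
  have -> : z.1 * (ei * r * ek) + z.2 * (ei * (ek * s)) =
    (ei * ek) * (z.1 * r + z.2 * s) by ring.
  move=> /eqP; rewrite !mulf_eq0 (negbTE ej0) (negbTE ek0) /= => /eqP e1.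
  move=> /eqP; rewrite !mulf_eq0 (negbTE ei0) (negbTE ek0) /= => /eqP e2.
  have z10 : z.1 = 0.
    have /eqP : z.1 * (r - q) = 0 by rewrite mulrBr; move: e1 e2; lra.
    by rewrite mulf_eq0 subr_eq0 (gt_eqF (lt_trans q0 r0)) orbF => /eqP.
  have z20 : z.2 = 0.
    by move/eqP: e2; rewrite z10 mul0r add0r mulf_eq0 (gt_eqF s0) orbF => /eqP.
  by apply: injective_projections.
move=> x y xy; apply/eqP; rewrite -subr_eq0; apply/eqP/ker.
by rewrite linearB /= xy subrr.
Qed.

Lemma tensor_surface_continuous : continuous Sigma.
Proof.
move=> t; apply: differentiable_continuous.
exact: (exp_trig2_rV_differentiable (tensor_surface_exp_trig2 esigma etau)).
Qed.

(* Taking logarithms of three exponential coordinates recovers (t_1, t_2). *)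
Lemma tensor_surface_embedding : topological_embedding Sigma.
Proof.
split; first exact: tensor_surface_continuous.
pose c i' k' (u : 'rV[R]_(m * n)) := ln (u 0 (mxtens_index (i', k'))).
pose h (u : 'rV[R]_(m * n)) : R * R :=
  ((c i k u - c j k u) / (r - q), (c i k u - c i l u) / (s - p)).
have SE t i' k' : Sigma t 0 (mxtens_index (i', k')) = sigma t.1 0 i' * tau t.2 0 k'.
  exact: tens_rV_coord.
have cE t i' k' x y : sigma t.1 0 i' = expR x -> tau t.2 0 k' = expR y ->
    c i' k' (Sigma t) = x + y.
  by move=> ex ey; rewrite /c SE ex ey -expRD expRK.
exists h; split.
- move=> t; rewrite /h (cE _ _ _ _ _ (coord_i _) (coord_k _))
    (cE _ _ _ _ _ (coord_j _) (coord_k _)) (cE _ _ _ _ _ (coord_i _) (coord_l _)).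
  apply: injective_projections => /=; field.
    by rewrite subr_eq0 gt_eqF// (lt_trans q0).
  by rewrite subr_eq0 gt_eqF// (lt_trans p0).
(* Continuity is checked at image points only: the coordinates used are positive there, so [ln] is
   continuous. *)
- apply: continuous_in_subspaceT => u /set_mem[t _ tu].
  have cc i' k' : (exists x y, sigma t.1 0 i' = expR x /\ tau t.2 0 k' = expR y) ->
      {for u, continuous (c i' k')}.
    move=> [x [y [ex ey]]].
    apply: (@continuous_comp _ _ _ (fun u : 'rV[R]_(m * n) => u 0 (mxtens_index (i', k'))) (@ln R)).
      exact: coord_continuous.
    apply: continuous_ln; rewrite -tu SE ex ey.
    by rewrite mulr_gt0// expR_gt0.
  have h1 : (fun v => (c i k v - c j k v) / (r - q)) @ u --> (h u).1.
    apply: (@continuousM R _ (fun v => c i k v - c j k v) (cst (r - q)^-1) u);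
      last exact: cst_continuous.
    apply: (@continuousB R R^o _ (c i k) (c j k) u); apply: cc;
      by do 2!eexists; split; eauto.
  have h2 : (fun v => (c i k v - c i l v) / (s - p)) @ u --> (h u).2.
    apply: (@continuousM R _ (fun v => c i k v - c i l v) (cst (s - p)^-1) u);
      last exact: cst_continuous.
    apply: (@continuousB R R^o _ (c i k) (c i l) u); apply: cc;
      by do 2!eexists; split; eauto.
  exact: (cvg_pair h1 h2).
Qed.

Lemma tensor_surface_proper : proper_map Sigma.
Proof.
move=> K cK; have [->|/set0P K0] := eqVneq K set0.
  by rewrite preimage_set0; exact: compact0.
have cdot : continuous (fun u : 'rV[R]_(m * n) => dotrv u u).
  have cc (o : 'I_(m * n)) : continuous (fun u : 'rV[R]_(m * n) => u 0 o * u 0 o).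
    by move=> u; apply: (@cvgM _ _ (nbhs u) _ (fun v : 'rV[R]_(m * n) => v 0 o)
      (fun v : 'rV[R]_(m * n) => v 0 o)); exact: (@coord_continuous R 1 (m * n) 0 o u).
  rewrite /dotrv; elim: (index_enum _) => [|o os IH].
    by under eq_fun do rewrite big_nil; exact: cst_continuous.
  under eq_fun do rewrite big_cons.
  by move=> u; exact: (@continuousD R R^o _ _ _ u (cc o u) (IH u)).
(* On the preimage [a * b] is at most [C]. Both factors are at least 1, so each is at most [C], and
   linear growth confines each time to a segment. *)
have [w _ wP] := compact_EVT_max K0 cK (continuous_subspaceT cdot).
have [_ _ [M M0 MP] _] := ha; have [_ _ [N N0 NP] _] := hb.
pose C := dotrv w w.
have clS : closed (Sigma @^-1` K).
  apply: preimage_closed; first by move=> t _; exact: tensor_surface_continuous.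
  by apply: compact_closed => //; exact: norm_hausdorff.
apply: (subclosed_compact clS (compact_setX
  (@segment_compact R (- (C / M)) (C / M)) (@segment_compact R (- (C / N)) (C / N)))).
move=> t /mem_set /wP; rewrite dotrv_tens -/(a t.1) -/(b t.2) -/C => tC.
have a1_ := profile_ge1 t.1 ha; have b1_ := profile_ge1 t.2 hb.
have aC : a t.1 <= C by rewrite (le_trans _ tC)// ler_peMr// (le_trans ler01).
have bC : b t.2 <= C by rewrite (le_trans _ tC)// ler_peMl// (le_trans ler01).
have bnd (x e B : R) : 0 < e -> 1 + e * `|x| <= B -> B <= C -> `|x| <= C / e.
  move=> e0 h1 h2; rewrite ler_pdivlMr// mulrC (le_trans _ h2)// (le_trans _ h1)//.
  by rewrite lerDr.
by split; rewrite /= in_itv/= -ler_norml; [exact: bnd M0 (MP _) aC|exact: bnd N0 (NP _) bC].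
Qed.

End surface.

(** * Exponential coordinates from the extreme real roots *)

Lemma size_ode_char_poly (R : realType) (n : nat) (c : 'I_n -> R) :
  size (complex_poly (ode_char_poly c)) = n.+1.
Proof.
rewrite size_map_poly /ode_char_poly size_polyDl ?size_polyXn// ltnS.
apply: (leq_trans (size_sum _ _ _)); apply/bigmax_leqP => j _.
by rewrite (leq_trans (size_scale_leq _ _))// size_polyXn.
Qed.

(** The listed real roots are distinct roots of a polynomial of degree [n]. Hence their exponentials
    all lie among the [n] entries kept by [ode_curve]. *)
Lemma real_roots_size (R : realType) (n : nat) (c : 'I_n -> R) (rs : seq R)
    (zs : seq R[i]) :
  root_enumeration (ode_char_poly c) rs zs -> (size rs <= n)%N.
Proof.
move=> [srs _ _ rootE]; rewrite -ltnS -(size_ode_char_poly c).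
rewrite -(size_map (fun r => r%:C) rs); apply: max_poly_roots.
- by rewrite -size_poly_gt0 size_ode_char_poly.
- by apply/allP => z zrs; rewrite rootE mem_cat zrs.
- rewrite map_inj_uniq; last by move=> x y [].
  by apply: sorted_uniq srs => [x y z /= yx zy|x /=]; [exact: lt_trans zy yx|rewrite ltxx].
Qed.

Lemma ode_curve_exp_trig (R : realType) (n : nat) (rs : seq R) (zs : seq R[i]) :
  exp_trig_rV (ode_curve n rs zs).
Proof.
move=> k; under eq_fun do rewrite mxE; move: (nat_of_ord k) => i.
elim: rs i => [|r rs IH] [|i] /=.
- elim: zs => [|z zs IHz] /=; first exact: exp_trig_cst.
  by apply: exp_trig_mul; [exact: exp_trig_exp|exact: exp_trig_cos].
(* The index is [i.+1] here, so the induction hypothesis misses the cosine that opens the next pair;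
   past the end, [nth] returns the constant 0. *)
- elim: zs i => [|z zs IHz] [|[|i]] /=; try exact: exp_trig_cst.
  + by apply: exp_trig_mul; [exact: exp_trig_exp|exact: exp_trig_sin].
  + case: zs IHz => [|z' zs] IHz /=; first exact: exp_trig_cst.
    by apply: exp_trig_mul; [exact: exp_trig_exp|exact: exp_trig_cos].
  + exact: IHz.
- exact: exp_trig_exp.
- exact: IH.
Qed.

Lemma ode_curve_real_coord (R : realType) (n : nat) (rs : seq R) (zs : seq R[i])
    (i : 'I_n) t :
  (i < size rs)%N -> ode_curve n rs zs t 0 i = expR (nth 0 rs i * t).
Proof. by move=> irs; rewrite mxE nth_cat size_map irs (nth_map 0). Qed.

Lemma ode_curve_extreme_coords (R : realType) (n : nat) (c : 'I_n -> R)
    (rs : seq R) (zs : seq R[i]) :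
  root_enumeration (ode_char_poly c) rs zs ->
  real_roots_dominant (ode_char_poly c) rs ->
  exists (i j : 'I_n) (r q : R), [/\ 0 < r, q < 0,
    forall t, ode_curve n rs zs t 0 i = expR (r * t)
    & forall t, ode_curve n rs zs t 0 j = expR (q * t)].
Proof.
move=> /real_roots_size srs [r0 _ q0 _].
(* An empty list would make [head 0 rs] the default 0, against its positivity. *)
have rs0 : (0 < size rs)%N by case: rs r0 {srs q0} => //=; rewrite ltxx.
have lrs : ((size rs).-1 < size rs)%N by rewrite prednK.
exists (Ordinal (leq_trans rs0 srs)), (Ordinal (leq_trans lrs srs)).
exists (head 0 rs), (last 0 rs); split=> // t.
- by rewrite ode_curve_real_coord//= nth0.
- by rewrite ode_curve_real_coord//= nth_last.
Qed.

Theorem theorem1p7 (R : realType) (n1 n2 : nat)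
    (hn1 : (2 <= n1)%N) (hn2 : (2 <= n2)%N)
    (c1 : 'I_n1 -> R) (c2 : 'I_n2 -> R)
    (rs : seq R) (zs : seq R[i]) (ss : seq R) (ws : seq R[i])
    (hroots1 : root_enumeration (ode_char_poly c1) rs zs)
    (hroots2 : root_enumeration (ode_char_poly c2) ss ws)
    (hsimple1 : simple_roots (ode_char_poly c1))
    (hsimple2 : simple_roots (ode_char_poly c2))
    (hdom1 : real_roots_dominant (ode_char_poly c1) rs)
    (hdom2 : real_roots_dominant (ode_char_poly c2) ss) :
  let Sigma := tensor_surface (ode_curve n1 rs zs) (ode_curve n2 ss ws) in
  [/\ proper_embedding Sigma,
      geodesically_complete (induced_metric Sigma)
    & surface_volume Sigma = +oo%E].
Proof.
have [i [j [r [q [r0 q0 ci cj]]]]] := ode_curve_extreme_coords hroots1 hdom1.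
have [k [l [s [p [s0 p0 ck cl]]]]] := ode_curve_extreme_coords hroots2 hdom2.
have e1 := @ode_curve_exp_trig R n1 rs zs; have e2 := @ode_curve_exp_trig R n2 ss ws.
move=> Sigma; split.
- split.
  + exact/exp_trig2_rV_smooth/tensor_surface_exp_trig2.
  + exact: (tensor_surface_immersion e1 e2 r0 q0 s0 ci cj ck).
  + exact: (tensor_surface_embedding e1 e2 r0 q0 s0 p0 ci cj ck cl).
  + exact: (tensor_surface_proper e1 e2 r0 q0 s0 p0 ci cj ck cl).
- exact: (tensor_surface_complete e1 e2 r0 q0 s0 p0 ci cj ck cl).
- exact: (tensor_surface_volume e1 e2 r0 q0 s0 p0 ci cj ck cl).
Qed.
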